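(* Let $c\in(0,1)$, let $s\ge 0$ be an integer, let $f\in C^s[0,\infty)$ be such that $L_{n,c}(f;w)$ is defined for all $w\ge 0$ and all sufficiently large $n$, and let $x\in[0,\infty)$. Then $$\lim_{n\to\infty}\frac{1}{\lambda_n(c,s)}\,\frac{d^s}{dw^s}L_{n,c}(f;w)\Big|_{w=x}=f^{(s)}(x).$$
   Context: For $c\in(0,1)$, integers $n\ge1$, $k\ge 0$, and $x,t\ge 0$ put $$p_{n,k}(x)=\frac{(n/c)_k\,(cx)^k}{k!\,(1+cx)^{\frac nc+k}},\qquad \theta_{n,k}(t)=\frac{n e^{-nt}(nt)^k}{k!},\qquad (n/c)_k=\prod_{i=0}^{k-1}\Big(\frac nc+i\Big),$$ with the convention $0^0=1$. The operator $L_{n,c}$ is $$L_{n,c}(f;x)=L_{n,c}f(x)=\sum_{k=0}^\infty p_{n,k}(x)\int_0^\infty\theta_{n,k}(t)f(t)\,dt .$$ ''$L_{n,c}(f;w)$ is defined for all $w\ge0$ and all sufficiently large $n$'' means: there is $n_0$ such that $\sum_{k}p_{n,k}(w)\int_0^\infty\theta_{n,k}(t)|f(t)|\,dt<\infty$ for all $n\ge n_0$ and all $w\ge0$. Derivatives at the point $0$ are one-sided. Further, $\lambda_n(c,s)=(n/c)_s\,c^s\,n^{-s}$. *)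

(* Defs.v *)
From HB Require Import structures.
From mathcomp Require Import all_boot all_order all_algebra.
From mathcomp Require Import all_classical all_reals all_analysis.

Set Implicit Arguments.
Unset Strict Implicit.
Unset Printing Implicit Defensive.

Import Order.TTheory GRing.Theory Num.Theory.
Import numFieldNormedType.Exports.

Local Open Scope classical_set_scope.
Local Open Scope ring_scope.

Section HalfLineCalculus.
Context {R : realType}.
Implicit Types (g : R -> R) (x : R) (s : nat).

Definition halfline : set R := `[0, +oo[.

Definition diff_quot g x : R -> R := fun y => (g y - g x) / (y - x).

(* The difference quotient only sees points y >= 0, y <> x: this is the usual
   two-sided derivative at x > 0 and the right derivative at x = 0.  Values of
   g outside [0, +oo) play no role for x >= 0. *)
Definition derivable_hl g x : Prop :=
  cvg (diff_quot g x @ within halfline x^').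

Definition derive_hl g : R -> R :=
  fun x => lim (diff_quot g x @ within halfline x^').

Definition derive_hln s g : R -> R := iter s derive_hl g.

(* derive_hln is total (lim has a default value), so the existence of the
   derivatives is recorded separately. *)
Definition derivable_hln s g : Prop :=
  forall i x, (i < s)%N -> 0 <= x -> derivable_hl (derive_hln i g) x.

Definition C_hl s g : Prop :=
  derivable_hln s g /\ {within halfline, continuous (derive_hln s g)}.

End HalfLineCalculus.

Section Operator.
Context {R : realType}.
Implicit Types (c x t w a : R) (f : R -> R) (n k s : nat).

Definition rising a k : R := \prod_(i < k) (a + i%:R).

Definition p_basis n c k x : R :=
  rising (n%:R / c) k * (c * x) ^+ k
  / (k`!%:R * (1 + c * x) `^ (n%:R / c + k%:R)).

Definition theta n k t : R :=
  n%:R * expR (- (n%:R * t)) * (n%:R * t) ^+ k / k`!%:R.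

(* Real-valued and total; it is the intended sum as soon as L_defined holds and
   n is large, the series and the integrals then being absolutely convergent. *)
Definition L_op n c f x : R :=
  limn (series (fun k => p_basis n c k x *
    \int[lebesgue_measure]_(t in halfline) (theta n k t * f t))).

Definition L_defined c f : Prop :=
  \forall n \near \oo, forall w, 0 <= w ->
    (\sum_(0 <= k <oo) ((p_basis n c k w)%:E *
       \int[lebesgue_measure]_(t in halfline) (theta n k t * `|f t|)%:E)
     < +oo)%E.

Definition lambda n c s : R := rising (n%:R / c) s * c ^+ s * n%:R ^- s.

End Operator.

(* Main.v *)
Require Import Defs.
From HB Require Import structures.
From mathcomp Require Import all_boot all_order all_algebra.
From mathcomp Require Import all_classical all_reals all_analysis.
From mathcomp Require Import measurable_realfun ring lra.

(** Writing y = c w and b = n / c, L_{n,c} f (w) is the negative binomial mean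
    N_b a (y) = (1 + y)^{-b} \sum_k (b)_k / k! a_k (y / (1 + y))^k of the
    coefficients a_k = \int_0^oo theta_{n,k} f, and N_b a has derivative
    b N_{b+1} (D a) with D the forward difference.  Hence the normalized s-th
    derivative is exactly n^s N_{n/c+s} (D^s a) (c x).

    Fix T = x + 1.  Integrating by parts s times on [0, T] turns n^s D^s of the
    truncated coefficients into \int_0^T theta_{n,k+s} f^{(s)}, which differs
    from f^{(s)}(x) by at most eps plus a constant times the second moment of
    theta_{n,k+s} around x; the mean of the latter is O(1 / n).  The boundary
    terms at T and the tail of f beyond T are bounded by a power of n times
    exp (- n (1 - 1/r) T) r^k for any r > 1; since the mean of r^k is
    (1 + y - r y)^{-b}, for r close to 1 this decays exponentially because
    T > x. *)

Set Implicit Arguments.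
Unset Strict Implicit.
Unset Printing Implicit Defensive.

Import Order.TTheory GRing.Theory Num.Theory.
Import numFieldNormedType.Exports.

Local Open Scope classical_set_scope.
Local Open Scope ring_scope.

(** * Coefficient sequences of subexponential growth *)

Section Subexponential.
Context {R : realType}.
Implicit Types (a u v : nat -> R) (b r y z : R).

(** Equivalently, the power series with coefficients [a] has radius of convergence at least 1. This
    class is closed under products, shifts and differences, and the ratio [y / (1 + y)] of a
    negative binomial series always lies inside the disc. *)
Definition subexp a := forall r, 1 < r -> exists M, forall k, `|a k| <= M * r ^+ k.

(* [b] is the parameter of the comparison sequence [(b)_k / k!], whose ratios tend to 1. *)
Lemma subexp_ratio b u : 0 < b ->
  (forall k, `|u k.+1| * k.+1%:R <= (b + k%:R) * `|u k|) -> subexp u.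
Proof.
move=> b0 hu r r1.
have r0 : 0 < r by apply: lt_trans r1.
have rr : 0 < r - 1 by rewrite subr_gt0.
(* From index [K] on the ratio [(b + k) / (k + 1)] is at most [r]; the sum [M] absorbs the finitely
   many terms before. *)
pose K := (Num.truncn (b / (r - 1))).+1.
have hK : b / (r - 1) < K%:R by exact: truncnS_gt.
pose M := \sum_(j < K.+1) `|u j|.
have hM j : (j <= K)%N -> `|u j| <= M.
  move=> jK; rewrite /M -[j]/(nat_of_ord (Ordinal (jK : j < K.+1)%N)).
  by rewrite (bigD1 (Ordinal (jK : j < K.+1)%N)) //= lerDl sumr_ge0.
have M0 : 0 <= M by apply: sumr_ge0.
exists M; elim=> [|k IH]; first by rewrite expr0 mulr1 hM.
have [kK|Kk] := leqP k.+1 K.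
  apply: le_trans (hM _ kK) _; rewrite ler_peMr //; apply: exprn_ege1; exact: ltW.
have Kk' : K%:R <= k%:R :> R by rewrite ler_nat.
have bk : b + k%:R <= r * k.+1%:R.
  have : b < (r - 1) * k%:R.
    by rewrite mulrC -ltr_pdivrMr //; apply: lt_le_trans Kk'.
  rewrite -natr1; nra.
rewrite -(ler_pM2r (ltr0Sn R k)) (le_trans (hu k)) //.
apply: le_trans (ler_wpM2r (normr_ge0 _) bk) _.
rewrite exprSr; have := ler_wpM2l (ltW (mulr_gt0 r0 (ltr0Sn R k))) IH.
by move=> /le_trans; apply; rewrite le_eqVlt; apply/orP; left; apply/eqP; ring.
Qed.

Lemma subexpM u v : subexp u -> subexp v -> subexp (fun k => u k * v k).
Proof.
move=> hu hv r r1.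
(* Each factor is bounded at rate [Num.sqrt r], so that the product grows at rate [r]. *)
have s1 : 1 < Num.sqrt r by rewrite -sqrtr1 ltr_sqrt // (lt_trans _ r1).
have [M hM] := hu _ s1; have [N hN] := hv _ s1; exists (M * N) => k.
rewrite normrM -{1}(sqr_sqrtr (ltW (lt_trans ltr01 r1))) -exprM mulnC exprM expr2.
by rewrite mulrACA ler_pM.
Qed.

Lemma subexpS u : subexp u -> subexp (fun k => u k.+1).
Proof.
move=> hu r r1; have [M hM] := hu r r1; exists (M * r) => k.
by rewrite -mulrA -exprS.
Qed.

Lemma subexpB u v : subexp u -> subexp v -> subexp (fun k => u k - v k).
Proof.
move=> hu hv r r1; have [M hM] := hu _ r1; have [N hN] := hv _ r1.
exists (M + N) => k; rewrite mulrDl (le_trans (ler_normB _ _)) //.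
by rewrite lerD.
Qed.

Lemma subexp_cst (l : R) : subexp (fun=> l).
Proof.
move=> r r1; exists `|l| => k; rewrite ler_peMr //.
by apply: exprn_ege1; exact: ltW.
Qed.

Lemma subexp_natS : subexp (fun k => k.+1%:R).
Proof.
apply: (@subexp_ratio 2) => // k.
by rewrite !normr_nat -!natrD -!natrM ler_nat mulnC.
Qed.

Lemma subexp_nat : subexp (fun k => k%:R).
Proof.
have := subexpB subexp_natS (subexp_cst 1).
by congr subexp; apply/funext => k; rewrite -natr1 addrK.
Qed.

Lemma subexp_cvg u z : subexp u -> `|z| < 1 ->
  cvgn (series (fun k => `|u k * z ^+ k|)).
Proof.
move=> hu z1.
(* This [r] satisfies both [1 < r] and [r * |z| < 1], which gives a convergent geometric
   majorant. *)
pose r := 2 / (1 + `|z|).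
have p : 0 < 1 + `|z| by rewrite ltr_wpDr.
have r1 : 1 < r by rewrite /r ltr_pdivlMr // mul1r; lra.
have rz : `|r * `|z| | < 1.
  rewrite ger0_norm; last by rewrite mulr_ge0 // ltW // (lt_trans ltr01).
  by rewrite /r mulrAC ltr_pdivrMr // mul1r; lra.
have [M hM] := hu r r1.
apply: (@series_le_cvg _ _ (geometric M (r * `|z|))) => [k|k|k|] //=.
- apply: mulr_ge0; first by have := le_trans (normr_ge0 _) (hM 0%N); rewrite expr0 mulr1.
  by rewrite exprn_ge0 // mulr_ge0 // ltW // (lt_trans ltr01).
- by rewrite normrM normrX exprMn mulrA ler_wpM2r // exprn_ge0.
- exact: is_cvg_geometric_series.
Qed.

Lemma subexp_pseries_cvg u z : subexp u -> `|z| < 1 -> cvgn (pseries u z).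
Proof. by move=> hu z1; apply: normed_cvg; exact: subexp_cvg. Qed.

Lemma subexp_diffs u : subexp u -> subexp (pseries_diffs u).
Proof. by move=> hu; apply: subexpM subexp_natS (subexpS hu). Qed.

Lemma is_derive_pseries u z : subexp u -> `|z| < 1 ->
  is_derive z 1 (fun z => limn (pseries u z)) (limn (pseries (pseries_diffs u) z)).
Proof.
(* Termwise differentiation at [z] asks for convergence of the series and of its first two formal
   derivatives at a point of larger modulus; [q] is the midpoint of [|z|] and 1. *)
move=> hu z1; pose q := (1 + `|z|) / 2.
have q0 : 0 <= q by rewrite divr_ge0 // addr_ge0.
have q1 : `|q| < 1 by rewrite ger0_norm // /q; lra.
apply: (@pseries_snd_diffs _ _ q); last by rewrite (ger0_norm q0) /q; lra.
- exact: subexp_pseries_cvg.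
- by apply: subexp_pseries_cvg => //; apply: subexp_diffs.
- by apply: subexp_pseries_cvg => //; do 2 apply: subexp_diffs.
Qed.

Lemma cvg_series_recl u l : series (fun k => u k.+1) @ \oo --> l ->
  series u @ \oo --> u 0%N + l.
Proof.
move=> cu.
have : [sequence series u n.+1]_n @ \oo --> u 0%N + l.
  rewrite [X in X @ _](_ : _ = fun n => u 0%N + series (fun k => u k.+1) n).
    by apply: cvgD => //; exact: cvg_cst.
  by apply/funext => n; rewrite /series /= big_nat_recl.
by rewrite cvg_shiftS.
Qed.
End Subexponential.

Lemma is_derive_congr (R : realType) (f g : R -> R) (x d e : R) :
  is_derive x 1 f d -> f =1 g -> d = e -> is_derive x 1 g e.
Proof. by move=> h /funext <- <-. Qed.

(** * Negative binomial means *)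

Section NegativeBinomial.
Context {R : realType}.
Implicit Types (a : nat -> R) (b r y z : R).

Lemma risingS b k : rising b k.+1 = rising b k * (b + k%:R).
Proof. by rewrite /rising big_ord_recr. Qed.

Lemma rising_recl b k : rising b k.+1 = b * rising (b + 1) k.
Proof.
rewrite /rising big_ord_recl addr0; congr (_ * _).
by apply: eq_bigr => i _; rewrite lift0 -nat1r addrA.
Qed.

Lemma rising_gt0 b k : 0 < b -> 0 < rising b k.
Proof. by move=> b0; apply: prodr_gt0 => i _; rewrite ltr_wpDr. Qed.

(** The coefficient of [z ^+ k] in the expansion of [(1 - z)] to the power [-b]. *)
Definition nbcoef b k : R := rising b k / k`!%:R.

Lemma nbcoef0 b : nbcoef b 0 = 1.
Proof. by rewrite /nbcoef /rising big_ord0 fact0 divr1. Qed.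

Lemma nbcoef_gt0 b k : 0 < b -> 0 < nbcoef b k.
Proof. by move=> b0; rewrite divr_gt0 ?rising_gt0 // ltr0n fact_gt0. Qed.

Lemma nbcoefS b k : k.+1%:R * nbcoef b k.+1 = (b + k%:R) * nbcoef b k.
Proof.
rewrite /nbcoef risingS factS natrM; field.
by rewrite nat1r !pnatr_eq0 -lt0n fact_gt0.
Qed.

Lemma nbcoefS_shift b k : k.+1%:R * nbcoef b k.+1 = b * nbcoef (b + 1) k.
Proof.
rewrite /nbcoef rising_recl factS natrM; field.
by rewrite nat1r !pnatr_eq0 -lt0n fact_gt0.
Qed.

Lemma nbcoef_pascal b k : nbcoef (b + 1) k.+1 = nbcoef (b + 1) k + nbcoef b k.+1.
Proof.
have h : k.+1%:R != 0 :> R by rewrite pnatr_eq0.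
apply: (mulfI h); rewrite mulrDr nbcoefS nbcoefS_shift.
by rewrite -natr1; ring.
Qed.

Lemma subexp_nbcoef b : 0 < b -> subexp (nbcoef b).
Proof.
move=> b0; apply: (subexp_ratio b0) => k.
have e j : `|nbcoef b j| = nbcoef b j by rewrite ger0_norm // ltW // nbcoef_gt0.
by rewrite !e mulrC nbcoefS.
Qed.

Definition nbsum b a y : R :=
  (1 + y) `^ (- b) * limn (pseries (fun k => nbcoef b k * a k) (y / (1 + y))).

Definition fdiff a : nat -> R := fun k => a k.+1 - a k.

Lemma subexp_fdiff a : subexp a -> subexp (fdiff a).
Proof. by move=> ha; apply: subexpB => //; exact: subexpS. Qed.

Lemma ratio_norm_lt1 y : 0 <= y -> `|y / (1 + y)| < 1.
Proof.
move=> y0; have p : 0 < 1 + y by rewrite ltr_wpDr.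
by rewrite ger0_norm ?divr_ge0 ?(ltW p) // ltr_pdivrMr // mul1r ltrDr.
Qed.

(** Write [p] for the original series, and [u], [v] for the series with parameter [b + 1] and the
    shifted, respectively unshifted, sequence. The formal derivative is [b * u] by [nbcoefS_shift],
    and Pascal's rule gives [v = p + z * u]; hence [b * u * (1 - z) - b * p = b * (u - v)]. *)
Lemma pseries_diffs_nbcoef b a z : 0 < b -> subexp a -> `|z| < 1 ->
  limn (pseries (pseries_diffs (fun k => nbcoef b k * a k)) z) * (1 - z)
    - b * limn (pseries (fun k => nbcoef b k * a k) z)
  = b * limn (pseries (fun k => nbcoef (b + 1) k * fdiff a k) z).
Proof.
move=> b0 ha z1.
have b10 : 0 < b + 1 by rewrite addr_gt0.
pose u k := nbcoef (b + 1) k * a k.+1.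
pose v k := nbcoef (b + 1) k * a k.
pose p k := nbcoef b k * a k.
have cu : cvgn (pseries u z).
  by apply: subexp_pseries_cvg => //; apply: subexpM (subexpS ha); exact: subexp_nbcoef.
have cv : cvgn (pseries v z).
  by apply: subexp_pseries_cvg => //; apply: subexpM ha; exact: subexp_nbcoef.
have cp : cvgn (pseries p z).
  by apply: subexp_pseries_cvg => //; apply: subexpM ha; exact: subexp_nbcoef.
have -> : limn (pseries (pseries_diffs p) z) = b * limn (pseries u z).
  apply/cvg_lim => //.
  rewrite [X in X @ _](_ : _ = fun n => b * pseries u z n); last first.
    apply/funext => n; rewrite /pseries /series /= mulr_sumr.
    apply: eq_bigr => k _; rewrite /pseries_diffs /p /u /= [k.+1%:R * _]mulrA.
    by rewrite nbcoefS_shift !mulrA.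
  by apply: cvgMr.
have -> : limn (pseries (fun k => nbcoef (b + 1) k * fdiff a k) z)
    = limn (pseries u z) - limn (pseries v z).
  apply/cvg_lim => //.
  rewrite [X in X @ _](_ : _ = fun n => pseries u z n - pseries v z n); last first.
    apply/funext => n; rewrite /pseries /series /= -sumrB.
    by apply: eq_bigr => k _; rewrite /fdiff /u /v; ring.
  exact: cvgB.
suff h : limn (pseries v z) = limn (pseries p z) + z * limn (pseries u z).
  by rewrite h; ring.
have : limn (pseries v z) - limn (pseries p z) = 0 + z * limn (pseries u z).
  rewrite -limB //; apply/cvg_lim => //.
  rewrite [X in X @ _](_ : _ = series (fun k => (v k - p k) * z ^+ k)); last first.
    apply/funext => n; rewrite /pseries /series /= fctE -sumrB.
    by apply: eq_bigr => k _; rewrite mulrBl.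
  have -> : 0 = (fun k => (v k - p k) * z ^+ k) 0%N.
    by rewrite /= /v /p !nbcoef0 subrr mul0r.
  apply: cvg_series_recl.
  rewrite [X in X @ _](_ : _ = fun n => z * pseries u z n); last first.
    apply/funext => n; rewrite /pseries /series /= mulr_sumr.
    by apply: eq_bigr => k _; rewrite /v /p /u nbcoef_pascal exprS; ring.
  exact: cvgMr.
by rewrite add0r; lra.
Qed.

(** With [z = y / (1 + y)] one has [z' = (1 + y) ^- 2] and [1 - z = (1 + y)^-1], so both terms of
    the product rule carry the factor [1 + y] to the power [- b - 1], and the remaining bracket is
    the one computed in [pseries_diffs_nbcoef]. *)
Lemma is_derive_nbsum b a y : 0 < b -> subexp a -> 0 <= y ->
  is_derive y 1 (nbsum b a) (b * nbsum (b + 1) (fdiff a) y).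
Proof.
move=> b0 ha y0; have p : 0 < 1 + y by rewrite ltr_wpDr.
have pn : 1 + y != 0 by rewrite gt_eqF.
have z1 := ratio_norm_lt1 y0.
set z := y / (1 + y) in z1.
have cs : subexp (fun k => nbcoef b k * a k) by apply: subexpM ha; exact: subexp_nbcoef.
pose g (t : R) := t / (1 + t).
pose F (t : R) := limn (pseries (fun k => nbcoef b k * a k) t).
pose pw (t : R) := t `^ (- b).
pose l (t : R) := 1 + t.
have dl : is_derive y 1 l 1.
  apply: (is_derive_congr (is_deriveD (is_derive_cst (1 : R) y 1) (is_derive_id y 1))) => //.
  by rewrite add0r.
have dg : is_derive y 1 g ((1 + y) ^- 2).
  have d1 : is_derive y 1 (fun t => (1 + t)^-1) (- (1 + y) ^- 2 *: 1).
    exact: (@is_deriveV _ l).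
  apply: (is_derive_congr (is_deriveM (is_derive_id y 1) d1)) => //.
  by rewrite /= /GRing.scale /= !mulr1; field.
have dF : is_derive (g y) 1 F (limn (pseries (pseries_diffs (fun k => nbcoef b k * a k)) z)).
  exact: is_derive_pseries.
have dpw : is_derive (l y) 1 pw (- b * (1 + y) `^ (- b - 1)) by exact: is_derive1_powR.
apply: (is_derive_congr (is_deriveM (is_derive1_comp dpw dl) (is_derive1_comp dF dg))) => //.
rewrite /nbsum [RHS]mulrCA -(pseries_diffs_nbcoef b0 ha z1) /pw /l /F /g /= -/z /GRing.scale /=.
have -> : - (b + 1) = - b - 1 by ring.
have -> : (1 + y) `^ (- b) = (1 + y) `^ (- b - 1) * (1 + y).
  rewrite -[X in _ * X]powRr1 ?ltW // -powRD ?subrK //.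
  by rewrite pn implybT.
have -> : 1 - z = (1 + y)^-1 by rewrite /z; field.
by field.
Qed.
End NegativeBinomial.

(** * Moments and generating function of the negative binomial mean *)

Section NegativeBinomialMoments.
Context {R : realType}.
Implicit Types (a : nat -> R) (b r y z : R).

(** The moments are found by integrating [is_derive_nbsum] from 0: a forward difference lowers the
    degree of a polynomial sequence, and at [y = 0] the mean is the zeroth coefficient. *)
Lemma is_derive_unique_from0 (f g h : R -> R) y : 0 <= y ->
  (forall t : R, 0 <= t -> is_derive t 1 f (h t)) ->
  (forall t : R, 0 <= t -> is_derive t 1 g (h t)) -> f 0 = g 0 -> f y = g y.
Proof.
move=> y0 df dg fg0.
have dfg (t : R) : 0 <= t -> is_derive t 1 (fun t => f t - g t) 0.
  by move=> t0; apply: (is_derive_congr (is_deriveB (df t t0) (dg t t0))); rewrite // subrr.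
have := @MVT_segment R (fun t => f t - g t) (fun=> 0) 0 y y0.
case.
- by move=> t /itvP tI; apply: dfg; rewrite tI.
- apply: derivable_within_continuous => t /itvP tI.
  by apply: (@ex_derive _ _ _ _ _ _ _ (dfg _ _)); rewrite tI.
- move=> t _; rewrite mul0r => /eqP; rewrite fg0 subrr subr0 subr_eq0 => /eqP //.
Qed.

Lemma nbsum0 b a : nbsum b a 0 = a 0%N.
Proof.
rewrite /nbsum addr0 mul0r powR1 mul1r; apply/cvg_lim => //.
(* Only the zeroth term survives, by [0 ^+ 0 = 1]; it is split off from a series of zeros. *)
have -> : a 0%N = (nbcoef b 0 * a 0%N) * 0 ^+ 0 + 0.
  by rewrite nbcoef0 mul1r mulr1 addr0.
apply: (@cvg_series_recl _ (fun k => nbcoef b k * a k * 0 ^+ k)).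
apply: cvg_near_cst; apply: nearW => n; rewrite /series /=.
by rewrite big1 // => i _; rewrite expr0n mulr0.
Qed.

Definition nbcvg b a y := cvgn (pseries (fun k => nbcoef b k * a k) (y / (1 + y))).

Lemma subexp_nbcvg b a y : 0 < b -> subexp a -> 0 <= y -> nbcvg b a y.
Proof.
move=> b0 ha y0; apply: subexp_pseries_cvg (ratio_norm_lt1 y0).
by apply: subexpM ha; exact: subexp_nbcoef.
Qed.

(* Convergence and value are stated together because [limn] is total. *)
Lemma nbsum_lin b a a' (l m : R) y : nbcvg b a y -> nbcvg b a' y ->
  nbcvg b (fun k => l * a k + m * a' k) y /\
  nbsum b (fun k => l * a k + m * a' k) y = l * nbsum b a y + m * nbsum b a' y.
Proof.
move=> ca ca'.
have h : pseries (fun k => nbcoef b k * (l * a k + m * a' k)) (y / (1 + y)) =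
   (fun n => l * pseries (fun k => nbcoef b k * a k) (y / (1 + y)) n +
             m * pseries (fun k => nbcoef b k * a' k) (y / (1 + y)) n).
  apply/funext => n; rewrite /pseries /series /= !mulr_sumr -big_split /=.
  by apply: eq_bigr => k _; ring.
have c : pseries (fun k => nbcoef b k * (l * a k + m * a' k)) (y / (1 + y)) @ \oo -->
   l * limn (pseries (fun k => nbcoef b k * a k) (y / (1 + y))) +
   m * limn (pseries (fun k => nbcoef b k * a' k) (y / (1 + y))).
  by rewrite h; apply: cvgD; apply: cvgMr.
split; first by apply/cvg_ex; eexists; exact: c.
by rewrite /nbsum (cvg_lim _ c) //; ring.
Qed.

Lemma nbsum_le b a a' y : 0 < b -> 0 <= y -> nbcvg b a y -> nbcvg b a' y ->
  (forall k, a k <= a' k) -> nbsum b a y <= nbsum b a' y.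
Proof.
move=> b0 y0 ca ca' aa'; rewrite /nbsum ler_wpM2l ?powR_ge0 //.
apply: lim_series_le => // n; rewrite ler_wpM2r //.
  by rewrite exprn_ge0 // divr_ge0 // addr_ge0.
by rewrite ler_wpM2l // ltW // nbcoef_gt0.
Qed.

Lemma nbsum_norm_le b a a' y : 0 < b -> 0 <= y -> nbcvg b a y -> nbcvg b a' y ->
  (forall k, `|a k| <= a' k) -> `|nbsum b a y| <= nbsum b a' y.
Proof.
move=> b0 y0 ca ca' aa'; rewrite ler_norml; apply/andP; split; last first.
  by apply: nbsum_le => // k; exact: le_trans (ler_norm _) (aa' k).
have [c e] := nbsum_lin (-1) 0 ca' ca'.
move: e; rewrite mulN1r mul0r addr0 => <-.
apply: nbsum_le => // k.
by have := aa' k; rewrite ler_norml /= mul0r addr0 mulN1r => /andP[].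
Qed.

Lemma nbsum_cst b (l : R) y : 0 < b -> 0 <= y -> nbsum b (fun=> l) y = l.
Proof.
move=> b0 y0; have b1 : 0 < b + 1 by rewrite addr_gt0.
apply: (@is_derive_unique_from0 _ (fun=> l) (fun=> 0) _ y0).
- move=> t t0; apply: (is_derive_congr (is_derive_nbsum b0 (subexp_cst l) t0)) => //.
  have c := subexp_nbcvg b1 (subexp_cst l) t0.
  have [_] := nbsum_lin 0 0 c c.
  have -> : (fun k => 0 * l + 0 * l) = fdiff (fun=> l).
    by apply/funext => k; rewrite /fdiff; ring.
  by move=> ->; rewrite !mul0r addr0 mulr0.
- by rewrite nbsum0.
Qed.

Lemma nbsum_nat b y : 0 < b -> 0 <= y -> nbsum b (fun k => k%:R) y = b * y.
Proof.
move=> b0 y0; have b1 : 0 < b + 1 by rewrite addr_gt0.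
apply: (@is_derive_unique_from0 _ (fun t => b * t) (fun=> b) _ y0).
- move=> t t0; apply: (is_derive_congr (is_derive_nbsum b0 subexp_nat t0)) => //.
  rewrite -[RHS]mulr1 -[X in _ = b * X](nbsum_cst 1 b1 t0); congr (b * nbsum _ _ _).
  by apply/funext => k; rewrite /fdiff /= -natr1; ring.
- move=> t _; apply: (is_derive_congr (is_deriveM (is_derive_cst b t 1) (is_derive_id t 1))) => //.
  by rewrite /= /GRing.scale /=; ring.
- by rewrite nbsum0 mulr0.
Qed.

Lemma subexp_bin2 : subexp (fun k => k%:R * (k%:R - 1) / 2 : R).
Proof.
apply: subexpM (subexp_cst _); apply: subexpM; first exact: subexp_nat.
exact: subexpB subexp_nat (subexp_cst 1).
Qed.

(** The polynomial [k (k - 1) / 2] replaces the square because its forward difference is exactly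
    [k], which reduces the claim to the first moment. *)
Lemma nbsum_bin2 b y : 0 < b -> 0 <= y ->
  nbsum b (fun k => k%:R * (k%:R - 1) / 2) y = b * (b + 1) * y ^+ 2 / 2.
Proof.
move=> b0 y0; have b1 : 0 < b + 1 by rewrite addr_gt0.
apply: (@is_derive_unique_from0 _ (fun t => b * (b + 1) * t ^+ 2 / 2)
  (fun t => b * ((b + 1) * t)) _ y0).
- move=> t t0; apply: (is_derive_congr (is_derive_nbsum b0 subexp_bin2 t0)) => //.
  rewrite -(nbsum_nat b1 t0); congr (b * nbsum _ _ _).
  by apply/funext => k; rewrite /fdiff /= -natr1; field.
- move=> t _.
  have d := is_deriveM (is_derive_id t 1) (is_derive_id t (1 : R)).
  apply: (is_derive_congr (is_deriveM (is_derive_cst (b * (b + 1) / 2) t 1) d)) => //.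
    by move=> u; rewrite /= !mulrfctE /cst; field.
  by rewrite /= !mulrfctE /cst /GRing.scale /=; field.
- by rewrite nbsum0 expr0n /= mulr0n !mulr0 !mul0r.
Qed.

(** This is the total mass 1 of the weights, read at [y = z / (1 - z)], where [y / (1 + y) = z]. *)
Lemma negative_binomial_series b z : 0 < b -> 0 <= z -> z < 1 ->
  limn (pseries (nbcoef b) z) = (1 - z) `^ (- b).
Proof.
move=> b0 z0 z1.
have p : 0 < 1 - z by rewrite subr_gt0.
have y0 : 0 <= z / (1 - z) by rewrite divr_ge0 // ltW.
have := nbsum_cst 1 b0 y0; rewrite /nbsum.
have e : 1 + z / (1 - z) = (1 - z)^-1 by field; rewrite gt_eqF.
rewrite e invrK divfK ?gt_eqF //.
under [X in pseries X]eq_fun do rewrite mulr1.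
rewrite -powR_inv1 ?ltW // -powRrM mulN1r opprK => h.
rewrite powRN; apply: (mulfI (lt0r_neq0 (powR_gt0 b p))).
by rewrite h mulfV // gt_eqF // powR_gt0.
Qed.

(** For [1 < r] the sequence [r ^+ k] is not [subexp], so convergence is established here as well:
    the condition [r * y < 1 + y] says that [r] times the ratio of the series stays below 1. *)
Lemma nbsum_geometric b r y : 0 < b -> 0 <= y -> 0 <= r -> r * y < 1 + y ->
  nbcvg b (fun k => r ^+ k) y /\
  nbsum b (fun k => r ^+ k) y = (1 + y - r * y) `^ (- b).
Proof.
move=> b0 y0 r0 ry.
have p : 0 < 1 + y by rewrite ltr_wpDr.
have e : pseries (fun k => nbcoef b k * r ^+ k) (y / (1 + y)) =
         pseries (nbcoef b) (r * (y / (1 + y))).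
  apply/funext => n; rewrite /pseries /series /=.
  by apply: eq_bigr => k _; rewrite [(r * _) ^+ _]exprMn mulrA.
have z0 : 0 <= r * (y / (1 + y)) by rewrite mulr_ge0 // divr_ge0 // ltW.
have z1 : r * (y / (1 + y)) < 1 by rewrite mulrA ltr_pdivrMr // mul1r.
split; first by rewrite /nbcvg e; apply: subexp_pseries_cvg (subexp_nbcoef b0) _;
  rewrite ger0_norm.
rewrite /nbsum e negative_binomial_series // -powRM ?subr_ge0 ?ltW //.
by congr (_ `^ _); field; rewrite gt_eqF.
Qed.
End NegativeBinomialMoments.
(** * One-sided calculus on the half-line *)

Section HalfLine.
Context {R : realType}.
Implicit Types (f g h : R -> R) (x t T : R).

Lemma halflineE t : halfline t = (0 <= t) :> Prop.
Proof. by rewrite /halfline /= in_itv /= andbT. Qed.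

Lemma within_halfline_dnbhsP x (P : set R) :
  within halfline x^' P <->
  exists2 e : R, 0 < e & forall y, 0 <= y -> y != x -> `|y - x| < e -> P y.
Proof.
split.
- move=> /nbhs_ballP[e /= e0 he]; exists e => // y y0 yx xy.
  have b : ball x e y by rewrite /ball /= distrC.
  by apply: (he y b yx); rewrite halflineE.
- move=> [e e0 he]; apply/nbhs_ballP; exists e => //= y xy yx.
  by rewrite halflineE => y0; apply: he => //; rewrite distrC.
Qed.

Lemma within_halfline_proper x : 0 <= x -> ProperFilter (within halfline x^').
Proof.
move=> x0; apply: Build_ProperFilter_ex => P /within_halfline_dnbhsP[e e0 he].
have e2 : 0 < e / 2 by rewrite divr_gt0.
exists (x + e / 2); apply: he; first by rewrite addr_ge0 // ltW.
- by rewrite gt_eqF // ltrDl.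
- by rewrite addrAC subrr add0r gtr0_norm //; lra.
Qed.

Lemma is_derive_dist h x d : is_derive x 1 h d <->
  forall e, 0 < e -> exists2 r : R, 0 < r &
    forall y, y != x -> `|y - x| < r -> `|d - (h y - h x) / (y - x)| < e.
Proof.
split.
- case=> hd dE e e0.
  have : k^-1 *: (h (k *: (1 : R) + x) - h x) @[k --> 0^'] --> d.
    by rewrite -dE; exact: hd.
  move=> /cvgrPdist_lt /(_ _ e0) /nbhs_ballP[r /= r0 hr]; exists r => // y yx xyr.
  have := hr (y - x); rewrite /ball /= sub0r normrN subr_eq0 => /(_ xyr yx).
  by rewrite /GRing.scale /= mulr1 subrK mulrC.
- move=> H.
  have c : k^-1 *: (h (k *: (1 : R) + x) - h x) @[k --> 0^'] --> d.
    apply/cvgrPdist_lt => e /H [r r0 hr]; apply/nbhs_ballP; exists r => //= k.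
    rewrite /ball /= sub0r normrN => kr k0.
    have := hr (k + x); rewrite addrK -subr_eq0 addrK => /(_ k0 kr).
    by rewrite /GRing.scale /= mulr1 mulrC.
  apply: DeriveDef; first by apply/cvg_ex; exists d.
  exact/cvg_lim.
Qed.

(** The operator is known to equal a negative binomial mean only for nonnegative arguments, whereas
    the mean is differentiable from both sides even at 0; this transfers its derivative to the
    half-line. *)
Lemma derive_hl_eq g h x d : 0 <= x -> (forall y, 0 <= y -> g y = h y) ->
  is_derive x 1 h d -> derivable_hl g x /\ derive_hl g x = d.
Proof.
move=> x0 gh /is_derive_dist hd; have F := within_halfline_proper x0.
have c : diff_quot g x @ within halfline x^' --> d.
  apply/cvgrPdist_lt => e /hd [r r0 hr]; apply/within_halfline_dnbhsP; exists r => //.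
  by move=> y y0 yx xyr; rewrite /diff_quot !gh //; exact: hr.
split; first by apply/cvg_ex; exists d.
exact/cvg_lim.
Qed.

Lemma derivable_hl_is_derive g x : 0 < x -> derivable_hl g x ->
  is_derive x 1 g (derive_hl g x).
Proof.
move=> x0 c; apply/is_derive_dist => e e0.
have F := within_halfline_proper (ltW x0).
have /cvgrPdist_lt/(_ _ e0)/within_halfline_dnbhsP[r r0 hr] :
  diff_quot g x @ within halfline x^' --> derive_hl g x by exact: c.
(* Cutting the radius at [x] keeps [y] in the half-line, where the one-sided quotient is
   controlled. *)
exists (Num.min r x); first by rewrite lt_min r0.
move=> y yx; rewrite lt_min => /andP[yr yx']; apply: hr => //.
by move: yx'; rewrite ltr_norml => /andP[]; lra.
Qed.

Lemma derivable_hl_continuous g x : 0 <= x -> derivable_hl g x ->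
  g @ within halfline (nbhs x) --> g x.
Proof.
move=> x0 c; apply/cvgrPdist_lt => e e0.
have F := within_halfline_proper x0.
have /cvgrPdist_lt/(_ _ ltr01)/within_halfline_dnbhsP[r r0 hr] :
  diff_quot g x @ within halfline x^' --> derive_hl g x by exact: c.
set d := derive_hl g x in hr.
have D : 0 < `|d| + 1 by rewrite ltr_wpDl.
apply/nbhs_ballP; exists (Num.min r (e / (`|d| + 1))) => /=.
  by rewrite lt_min r0 divr_gt0.
move=> y; rewrite /ball /= lt_min => /andP[yr ye]; rewrite halflineE => y0.
have [->|yx] := eqVneq y x; first by rewrite subrr normr0.
have h1 := hr y y0 yx; rewrite distrC in h1; move: (h1 yr); rewrite /diff_quot => h2.
have q : `|(g y - g x) / (y - x)| < `|d| + 1.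
  have := ler_normB d (d - (g y - g x) / (y - x)).
  by rewrite opprB addrC subrK => /le_lt_trans; apply; rewrite ltrD2l.
rewrite distrC -[g y - g x](@divfK _ (y - x)) ?subr_eq0 // normrM.
rewrite ltr_pdivlMr // distrC in ye.
apply: le_lt_trans ye; rewrite mulrC; apply: ler_wpM2l => //; exact: ltW.
Qed.

Lemma C_hl_continuous s f i : C_hl s f -> (i <= s)%N ->
  {within halfline, continuous (derive_hln i f)}.
Proof.
move=> [df cf]; rewrite leq_eqVlt => /orP[/eqP -> //|lis].
apply/subspace_continuousP => x; rewrite halflineE => x0.
by apply: derivable_hl_continuous => //; exact: df.
Qed.

(** This has the form that integration by parts asks for: two-sided derivatives inside the segment,
    and only one-sided continuity at its ends, so the right derivative at 0 causes no trouble. *)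
Lemma C_hl_segment s f i T : C_hl s f -> (i < s)%N -> 0 < T ->
  derivable_oo_LRcontinuous (derive_hln i f) 0 T /\
  {in `]0, T[, derive1 (derive_hln i f) =1 derive_hln i.+1 f}.
Proof.
move=> hf lis T0.
have d t : 0 < t -> is_derive t 1 (derive_hln i f) (derive_hln i.+1 f t).
  by move=> t0; apply: derivable_hl_is_derive => //; case: hf => df _; apply: df => //; exact: ltW.
have c : {within `[0, T], continuous (derive_hln i f)}.
  apply: continuous_subspaceW (C_hl_continuous hf (ltnW lis)) => t /=.
  by rewrite halflineE in_itv /= => /andP[].
move/(continuous_within_itvP _ T0): c => [_ c0 cT].
split; last first.
  move=> t; rewrite in_itv /= => /andP[t0 _].
  by rewrite derive1E; case: (d t t0).
split => // t; rewrite in_itv /= => /andP[t0 _].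
by case: (d t t0).
Qed.
End HalfLine.
(** * The Gamma kernel on a segment *)

Section Theta.
Context {R : realType}.
Implicit Types (f g : R -> R) (r t T : R) (n k : nat).

Lemma theta_ge0 n k t : 0 <= t -> 0 <= theta n k t.
Proof.
by move=> t0; rewrite /theta !mulr_ge0 ?expR_ge0 // ?exprn_ge0 ?mulr_ge0 // invr_ge0.
Qed.

Lemma thetaS0 n k : theta n k.+1 0 = 0 :> R.
Proof. by rewrite /theta mulr0 expr0n /= mulr0 mul0r. Qed.

Lemma theta_shift n k t : (0 < n)%N ->
  t * theta n k t = k.+1%:R / n%:R * theta n k.+1 t.
Proof.
move=> n0; rewrite /theta factS natrM exprS; field.
by rewrite !pnatr_eq0 !nat1r !pnatr_eq0 -!lt0n n0 fact_gt0.
Qed.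

(** At [k = 0] the predecessor [k.-1] is harmless because of the factor [k%:R]. *)
Lemma is_derive_theta n k t : is_derive t 1 (theta n k)
  (n%:R * (k%:R * (n%:R * (n%:R * t) ^+ k.-1)) * expR (- (n%:R * t)) / k`!%:R
   - n%:R * theta n k t).
Proof.
pose N : R := n%:R.
have dl : is_derive t 1 (fun u => - (N * u)) (- N).
  apply: (is_derive_congr (is_deriveN (is_deriveZ N (is_derive_id t 1)))) => //.
  by rewrite /GRing.scale /= mulr1.
have de := @is_derive1_comp R expR (fun u => - (N * u)) t _ _ (is_derive_expR _) dl.
have dm : is_derive t 1 (fun u => N * u) N.
  apply: (is_derive_congr (is_deriveZ N (is_derive_id t 1))) => //.
  by rewrite /GRing.scale /= mulr1.
have dX := is_deriveX k dm.
apply: (is_derive_congr (is_deriveZ (N / k`!%:R) (is_deriveM de dX))).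
  move=> u /=; rewrite /theta -/N /GRing.scale /= mulrfctE exprfctE /=; field.
  by rewrite pnatr_eq0 -lt0n fact_gt0.
rewrite /theta -/N /GRing.scale /= exprfctE /=.
by field; rewrite pnatr_eq0 -lt0n fact_gt0.
Qed.

Lemma is_derive_thetaS n k t : (0 < n)%N ->
  is_derive t 1 (theta n k.+1) (n%:R * (theta n k t - theta n k.+1 t)).
Proof.
move=> n0; apply: (is_derive_congr (is_derive_theta n k.+1 t)) => //.
rewrite mulrBr; congr (_ - _); rewrite /theta factS natrM /=; field.
by rewrite !nat1r !pnatr_eq0 -!lt0n fact_gt0.
Qed.

Lemma continuous_theta n k : continuous (@theta R n k).
Proof.
move=> t; have [d _] := is_derive_theta n k t.
exact/differentiable_continuous/derivable1_diffP.
Qed.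

Lemma exprn_fact_le_expR k t : 0 <= t -> t ^+ k / k`!%:R <= expR t.
Proof.
move=> t0; case: k => [|k].
  by rewrite expr0 fact0 divr1; apply: le_trans (expR_ge1Dx t); rewrite lerDl.
by apply: le_trans (expR_ge1Dxn k t0); rewrite lerDr.
Qed.

(* Chernoff's trick: [(n t)^k / k! = r^k (n t / r)^k / k! <= r^k exp (n t / r)]. *)
Lemma theta_le n k r t : 0 < r -> 0 <= t ->
  theta n k t <= n%:R * r ^+ k * expR (- (n%:R * (1 - r^-1) * t)).
Proof.
move=> r0 t0; have rn : r != 0 by rewrite gt_eqF.
have -> : theta n k t = n%:R * r ^+ k * expR (- (n%:R * t)) *
    ((n%:R * t / r) ^+ k / k`!%:R).
  rewrite /theta expr_div_n; field.
  by rewrite expf_neq0 // pnatr_eq0 -lt0n fact_gt0.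
have -> : - (n%:R * (1 - r^-1) * t) = - (n%:R * t) + n%:R * t / r by ring.
rewrite expRD [leRHS]mulrA ler_wpM2l //.
  by rewrite mulr_ge0 ?expR_ge0 // mulr_ge0 // exprn_ge0 // ltW.
by apply: exprn_fact_le_expR; rewrite divr_ge0 ?mulr_ge0 // ltW.
Qed.

Definition theta_int n T g k : R := \int[lebesgue_measure]_(t in `[0, T]) (theta n k t * g t).

Lemma segment_integrable T g : {within `[0, T], continuous g} ->
  lebesgue_measure.-integrable `[0, T] (EFin \o g).
Proof. by apply: continuous_compact_integrable; exact: segment_compact. Qed.

Lemma theta_mul_continuous n k T g : {within `[0, T], continuous g} ->
  {within `[0, T], continuous (fun t => theta n k t * g t)}.
Proof.
move=> cg t; apply: continuousM; last exact: cg.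
by apply: continuous_subspaceT => u; exact: continuous_theta.
Qed.

(** By [is_derive_thetaS], the left side is minus the integral of [g] against the derivative of
    [theta n k.+1]. Integration by parts moves the derivative onto [g]; as [theta n k.+1] vanishes
    at 0, only the boundary term at [T] is left. *)
Lemma theta_int_parts n k T g g' : (0 < n)%N -> 0 < T ->
  {within `[0, T], continuous g'} -> derivable_oo_LRcontinuous g 0 T ->
  {in `]0, T[, derive1 g =1 g'} ->
  n%:R * fdiff (theta_int n T g) k = theta_int n T g' k.+1 - theta n k.+1 T * g T.
Proof.
move=> n0 T0 cg' dg gg'.
have cg := derivable_oo_LRcontinuous_within dg.
have ct j : {within `[0, T], continuous (@theta R n j)}.
  by apply: continuous_subspaceT => u; exact: continuous_theta.
have cd : {within `[0, T], continuous (fun t => n%:R * (theta n k t - theta n k.+1 t) : R)}.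
  apply: continuous_subspaceT => u.
  by apply: cvgMr; apply: cvgB; exact: continuous_theta.
have dth : derivable_oo_LRcontinuous (@theta R n k.+1) 0 T.
  have := ct k.+1 => /(continuous_within_itvP _ T0)[_ h0 hT].
  by split => // t _; case: (is_derive_thetaS k t n0).
have eth : {in `]0, T[, derive1 (@theta R n k.+1) =1 (fun t => n%:R * (theta n k t - theta n k.+1 t))}.
  by move=> t _; rewrite derive1E; case: (is_derive_thetaS k t n0).
have := Rintegration_by_parts T0 cg' dg gg' cd dth eth.
rewrite thetaS0 mulr0 subr0.
have -> : \int[lebesgue_measure]_(t in `[0, T]) (g' t * theta n k.+1 t) = theta_int n T g' k.+1.
  by apply: eq_Rintegral => t _; rewrite mulrC.
have -> : \int[lebesgue_measure]_(t in `[0, T]) (g t * (n%:R * (theta n k t - theta n k.+1 t)))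
   = n%:R * (theta_int n T g k - theta_int n T g k.+1).
  rewrite /theta_int -RintegralB //; try (apply: segment_integrable; exact: theta_mul_continuous).
  rewrite -RintegralZl //.
    by apply: eq_Rintegral => t _; ring.
  apply: segment_integrable => t.
  exact: (cvgB (@theta_mul_continuous n k T g cg t) (@theta_mul_continuous n k.+1 T g cg t)).
by rewrite /fdiff => h; rewrite -opprB mulrN h; ring.
Qed.

(** The family [D] stands for the successive derivatives of [D 0]. Every integration by parts raises
    the kernel index by one, hence [k + s], and leaves one boundary term, bounded by [theta_le]. *)
Lemma theta_int_iter_diff T r (D : nat -> R -> R) s : 0 < T -> 1 < r ->
  (forall i, (i <= s)%N -> {within `[0, T], continuous (D i)}) ->
  (forall i, (i < s)%N -> derivable_oo_LRcontinuous (D i) 0 T /\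
     {in `]0, T[, derive1 (D i) =1 D i.+1}) ->
  exists2 C : R, 0 <= C & forall n k, (0 < n)%N ->
    `|n%:R ^+ s * iter s fdiff (theta_int n T (D 0%N)) k - theta_int n T (D s) (k + s)|
      <= C * n%:R ^+ s.+1 * expR (- (n%:R * (1 - r^-1) * T)) * r ^+ k.
Proof.
move=> T0 r1; have r0 : 0 < r by apply: lt_trans r1.
elim: s => [|s IH] hc hd.
  exists 0 => // n k n0; by rewrite /= expr0 mul1r addn0 subrr normr0 !mul0r.
have [C C0 hC] := IH (fun i h => hc i (leqW h)) (fun i h => hd i (leqW h)).
(* Differencing the previous error costs the factor [r + 1]; the second summand bounds the new
   boundary term, whose kernel index is [k + s + 1]. *)
exists (C * (r + 1) + `|D s T| * r ^+ s.+1).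
  by rewrite addr_ge0 // mulr_ge0 // ?exprn_ge0 ?addr_ge0 // ltW.
move=> n k n0; have n1 : 1 <= n%:R :> R by rewrite ler1n.
have [dD eD] := hd s (ltnSn s).
have := theta_int_parts (k + s) n0 T0 (hc s.+1 (leqnn _)) dD eD.
have h1 := hC n k n0; have h2 := hC n k.+1 n0.
set E := expR _ in h1 h2 *; have E0 : 0 <= E by exact: expR_ge0.
have h3 := theta_le n (k + s).+1 r0 (ltW T0); rewrite -/E in h3.
have h4 := theta_ge0 n (k + s).+1 (ltW T0).
rewrite iterS /fdiff -[X in _ = X - _ -> _]/(theta_int _ _ _ _) -addnS.
set I := iter s _ _ in h1 h2 *.
set e1 := _ - _ in h1; set e2 := _ - _ in h2.
move=> h.
have -> : n%:R ^+ s.+1 * (I k.+1 - I k) - theta_int n T (D s.+1) (k + s.+1) =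
   n%:R * (e2 - e1) - theta n (k + s.+1) T * D s T.
  rewrite exprSr /e1 /e2 addSn -addnS -mulrA.
  by rewrite -[theta_int n T (D s.+1) _](subrK (theta n (k + s.+1) T * D s T)) -h; ring.
apply: le_trans (ler_normB _ _) _.
rewrite (normrM _ (e2 - e1)) (normrM _ (D s T)) normr_nat addnS (ger0_norm h4).
have h5 : `|e2 - e1| <= C * n%:R ^+ s.+1 * E * r ^+ k * (r + 1).
  by apply: le_trans (ler_normB _ _) _; rewrite mulrDr mulr1; apply: lerD => //; rewrite -mulrA -exprSr.
have h6 : n%:R * `|e2 - e1| <= C * (r + 1) * n%:R ^+ s.+2 * E * r ^+ k.
  apply: le_trans (ler_wpM2l _ h5) _; first by rewrite ler0n.
  by rewrite (exprS _ s.+1) le_eqVlt; apply/orP; left; apply/eqP; ring.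
have h7 : theta n (k + s).+1 T * `|D s T| <= `|D s T| * r ^+ s.+1 * n%:R ^+ s.+2 * E * r ^+ k.
  apply: le_trans (ler_wpM2r (normr_ge0 _) h3) _.
  have h8 : n%:R <= n%:R ^+ s.+2 :> R by rewrite ler_eXnr.
  have h9 : 0 <= `|D s T| * r ^+ s.+1 * E * r ^+ k.
    by rewrite !mulr_ge0 // exprn_ge0 // ltW.
  have := ler_wpM2r h9 h8; rewrite -addnS exprD.
  by congr (_ <= _); ring.
by apply: le_trans (lerD h6 h7) _; rewrite !mulrDl.
Qed.
End Theta.

(** * Mass, second moment and concentration of the Gamma kernel on a segment *)

Section ThetaApproximation.
Context {R : realType}.
Implicit Types (f g phi : R -> R) (r t x T : R) (n k m : nat).

Lemma theta_int_lin n T g g' (l l' : R) m :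
  {within `[0, T], continuous g} -> {within `[0, T], continuous g'} ->
  theta_int n T (fun t => l * g t + l' * g' t) m = l * theta_int n T g m + l' * theta_int n T g' m.
Proof.
move=> cg cg'; rewrite /theta_int.
have i h : {within `[0, T], continuous h} ->
   lebesgue_measure.-integrable `[0, T] (EFin \o (fun t => theta n m t * h t)).
  by move=> ch; apply: segment_integrable; exact: theta_mul_continuous.
have ic h a : {within `[0, T], continuous h} ->
   lebesgue_measure.-integrable `[0, T] (EFin \o (fun t => a * (theta n m t * h t))).
  move=> ch; apply: segment_integrable => t; apply: cvgMr.
  exact: (@theta_mul_continuous R n m T h ch t).
rewrite -!RintegralZl ?i // -RintegralD ?ic //.
by apply: eq_Rintegral => t _; ring.
Qed.

Lemma theta_int_le n T g g' m : {within `[0, T], continuous g} ->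
  {within `[0, T], continuous g'} -> (forall t, 0 <= t <= T -> g t <= g' t) ->
  theta_int n T g m <= theta_int n T g' m.
Proof.
move=> cg cg' h; apply: le_Rintegral => //; try (apply: segment_integrable; exact: theta_mul_continuous).
move=> t /=; rewrite in_itv /= => tT; apply: ler_wpM2l; last exact: h.
by apply: theta_ge0; case/andP: tT.
Qed.

Lemma theta_mass0 n T : (0 < n)%N -> 0 < T ->
  theta_int n T (fun=> 1) 0 = 1 - expR (- (n%:R * T)).
Proof.
move=> n0 T0; have nn : n%:R != 0 :> R by rewrite pnatr_eq0 -lt0n.
have ct : {within `[0, T], continuous (@theta R n 0)}.
  by apply: continuous_subspaceT => u; exact: continuous_theta.
have dF (t : R) : is_derive t 1 (fun u => - n%:R^-1 * theta n 0 u) (theta n 0 t).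
  apply: (is_derive_congr (is_deriveZ (- n%:R^-1 : R) (is_derive_theta n 0 t))) => //.
  by rewrite /GRing.scale /= mul0r mulr0 !mul0r sub0r; field.
have cF : {within `[0, T], continuous (fun u => - n%:R^-1 * theta n 0 u : R)}.
  by apply: continuous_subspaceT => u; apply: cvgMr; exact: continuous_theta.
have dlr : derivable_oo_LRcontinuous (fun u => - n%:R^-1 * theta n 0 u : R) 0 T.
  move: cF => /(continuous_within_itvP _ T0)[_ h0 hT].
  by split => // t _; case: (dF t).
have eF : {in `]0, T[, derive1 (fun u => - n%:R^-1 * theta n 0 u : R) =1 theta n 0}.
  by move=> t _; rewrite derive1E; case: (dF t).
rewrite /theta_int /Rintegral.
under eq_integral do rewrite mulr1.
rewrite (continuous_FTC2 T0 ct dlr eF) /= /theta !mulr0 oppr0 expR0 !expr0 fact0.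
by field.
Qed.

Lemma theta_massS n T m : (0 < n)%N -> 0 < T ->
  theta_int n T (fun=> 1) m.+1 = theta_int n T (fun=> 1) m - theta n m.+1 T / n%:R.
Proof.
move=> n0 T0; have nn : n%:R != 0 :> R by rewrite pnatr_eq0 -lt0n.
have c l : {within `[0, T], continuous (fun=> l : R)} by move=> u; exact: cvg_cst.
have dlr : derivable_oo_LRcontinuous (fun=> 1 : R) 0 T.
  have := c 1 => /(continuous_within_itvP _ T0)[_ h0 hT].
  by split => // t _; exact: derivable_cst.
have e : {in `]0, T[, derive1 (fun=> 1 : R) =1 fun=> 0}.
  by move=> t _; exact: derive1_cst.
have := theta_int_parts m n0 T0 (c 0) dlr e.
have -> : theta_int n T (fun=> 0) m.+1 = 0.
  by have := theta_int_lin n 0 0 m.+1 (c 0) (c 0); rewrite !mul0r !addr0.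
rewrite sub0r mulr1 /fdiff => h; apply: (mulfI nn); rewrite mulrBr.
by move: h; rewrite mulrBr => h; rewrite [n%:R * (_ / _)]mulrC divfK //; lra.
Qed.

(** By [theta_massS] the missing mass grows with [m] by boundary terms of size at most
    [E * r ^+ m.+1], with [E] the exponential factor; the denominator [r - 1] comes from the
    geometric sum. *)
Lemma theta_mass_bound n T r m : (0 < n)%N -> 0 < T -> 1 < r ->
  0 <= 1 - theta_int n T (fun=> 1) m <= expR (- (n%:R * (1 - r^-1) * T)) * r ^+ m.+1 / (r - 1).
Proof.
move=> n0 T0 r1; have r0 : 0 < r by apply: lt_trans r1.
have p : 0 < r - 1 by rewrite subr_gt0.
have n0' : 0 < n%:R :> R by rewrite ltr0n.
have nn : n%:R != 0 :> R by rewrite gt_eqF.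
set E := expR _; have E0 : 0 <= E by exact: expR_ge0.
elim: m => [|m /andP[IH1 IH2]].
  rewrite theta_mass0 // opprB addrC subrK expR_ge0 /= expr1.
  have := theta_le n 0 r0 (ltW T0); rewrite -/E /theta !expr0 fact0 divr1 !mulr1 ler_pM2l // => h.
  by apply: le_trans h _; rewrite ler_pdivlMr // ler_wpM2l //; lra.
have h1 := theta_ge0 n m.+1 (ltW T0).
have h2 : theta n m.+1 T / n%:R <= E * r ^+ m.+1.
  rewrite ler_pdivrMr // ; apply: le_trans (theta_le _ _ r0 (ltW T0)) _.
  by rewrite -/E le_eqVlt; apply/orP; left; apply/eqP; ring.
rewrite theta_massS // opprB addrA [1 + _]addrC -addrA; apply/andP; split.
  by apply: addr_ge0 => //; rewrite divr_ge0 // ltW.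
apply: le_trans (lerD h2 IH2) _.
by rewrite le_eqVlt; apply/orP; left; apply/eqP; rewrite (exprS _ m.+1); field; rewrite gt_eqF.
Qed.

(* The value of [\int_0^oo theta_{n,m}(t) (t - x)^2 dt]. *)
Definition quad n x m : R :=
  m.+1%:R * m.+2%:R / n%:R ^+ 2 - 2 * x * m.+1%:R / n%:R + x ^+ 2.

Lemma theta_int_square n T x m r : (0 < n)%N -> 0 < T -> 1 < r ->
  theta_int n T (fun t => (t - x) ^+ 2) m <=
  quad n x m + x ^+ 2 * r * expR (- (n%:R * (1 - r^-1) * T)) * r ^+ m.
Proof.
move=> n0 T0 r1; have r0 : 0 < r by apply: lt_trans r1.
have n0' : 0 < n%:R :> R by rewrite ltr0n.
have nn : n%:R != 0 :> R by rewrite gt_eqF.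
pose G := theta_int n T (fun=> 1).
have c l : {within `[0, T], continuous (fun=> l : R)} by move=> u; exact: cvg_cst.
have i k : lebesgue_measure.-integrable `[0, T] (EFin \o (fun t => theta n k t * 1)).
  by apply: segment_integrable; exact: theta_mul_continuous.
have iZ k l : lebesgue_measure.-integrable `[0, T] (EFin \o (fun t => l * (theta n k t * 1))).
  apply: segment_integrable => t; apply: cvgMr.
  exact: (@theta_mul_continuous R n k T _ (c 1) t).
(* Each factor [t] is traded for a higher kernel index by [theta_shift], so that only masses on the
   segment remain. *)
have -> : theta_int n T (fun t => (t - x) ^+ 2) m =
   m.+1%:R * m.+2%:R / n%:R ^+ 2 * G m.+2 + - (2 * x * m.+1%:R / n%:R) * G m.+1 + x ^+ 2 * G m.
  rewrite /G /theta_int -!RintegralZl // -RintegralD // -RintegralD //.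
    apply: eq_Rintegral => t _.
    have h1 := theta_shift m t n0; have h2 := theta_shift m.+1 t n0.
    have -> : m.+1%:R * m.+2%:R / n%:R ^+ 2 * (theta n m.+2 t * 1) = t * (t * theta n m t).
      rewrite h1; transitivity (m.+1%:R / n%:R * (t * theta n m.+1 t)); last by ring.
      by rewrite h2; field.
    have -> : - (2 * x * m.+1%:R / n%:R) * (theta n m.+1 t * 1) = - 2 * x * (t * theta n m t).
      by rewrite h1; field.
    ring.
  apply: segment_integrable => t; apply: cvgD; apply: cvgMr;
  exact: (@theta_mul_continuous R n _ T _ (c 1) t).
have G1 : G m.+1 <= 1 by have /andP[] := theta_mass_bound m.+1 n0 T0 r1; rewrite subr_ge0.
have h1 := theta_massS m n0 T0; have h2 := theta_massS m.+1 n0 T0; rewrite -/G in h1 h2.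
have t1 := theta_ge0 n m.+1 (ltW T0); have t2 := theta_ge0 n m.+2 (ltW T0).
have h3 : G m = G m.+1 + theta n m.+1 T / n%:R by rewrite h1 subrK.
(* [G] is nonincreasing, so the three masses can be compared with the middle one:
   this leaves the full second moment and one boundary term. *)
have h4 : G m.+2 <= G m.+1 by rewrite h2 gerBl divr_ge0 // ltW.
have h5 : theta n m.+1 T / n%:R <= r * expR (- (n%:R * (1 - r^-1) * T)) * r ^+ m.
  rewrite ler_pdivrMr // ; apply: le_trans (theta_le _ _ r0 (ltW T0)) _.
  by rewrite le_eqVlt; apply/orP; left; apply/eqP; rewrite exprS; ring.
have q0 : 0 <= quad n x m.
  have -> : quad n x m = (m.+1%:R / n%:R - x) ^+ 2 + m.+1%:R / n%:R ^+ 2.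
    by rewrite /quad -[m.+2%:R]natr1; field.
  by rewrite addr_ge0 ?sqr_ge0 // divr_ge0 // exprn_ge0 // ltW.
have h6 : m.+1%:R * m.+2%:R / n%:R ^+ 2 * G m.+2 <= m.+1%:R * m.+2%:R / n%:R ^+ 2 * G m.+1.
  by rewrite ler_wpM2l // divr_ge0 ?mulr_ge0 // exprn_ge0 // ltW.
have h7 : quad n x m * G m.+1 <= quad n x m by rewrite ler_piMr.
have h8 := ler_wpM2l (sqr_ge0 x) h5.
rewrite h3; move: h6 h7 h8; rewrite /quad.
move: (_ / n%:R ^+ 2) => A; move: (2 * _ * _ / _) => B; move: (_ / n%:R) (x ^+ 2) => th X.
rewrite -!mulrA; move: (r * _) (G m.+1) (G m.+2) => W G1' G2'; lra.
Qed.

(** A Chebyshev argument. Within distance [d] of [x], continuity keeps [phi] within [eps] of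
    [phi x]; farther away the deviation is at most its maximum [M], hence at most [M / d ^+ 2] times
    [(t - x) ^+ 2]. The missing mass, multiplied by [phi x], goes into the exponential term. *)
Lemma theta_int_approx T r phi x eps : 0 <= x -> x < T -> 1 < r ->
  {within `[0, T], continuous phi} -> 0 < eps ->
  exists C C' : R, [/\ 0 <= C, 0 <= C' & forall n m, (0 < n)%N ->
    `|theta_int n T phi m - phi x| <=
      eps + C * quad n x m + C' * expR (- (n%:R * (1 - r^-1) * T)) * r ^+ m].
Proof.
move=> x0 xT r1 cphi e0; have T0 : 0 < T by apply: le_lt_trans xT.
have r0 : 0 < r by apply: lt_trans r1.
have p : 0 < r - 1 by rewrite subr_gt0.
have cd : {within `[0, T], continuous (fun t => phi t - phi x)}.
  by move=> t; apply: cvgB; [exact: cphi|exact: cvg_cst].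
have cn : {within `[0, T], continuous (fun t => `|phi t - phi x|)}.
  by move=> t; apply: cvg_norm; exact: cd.
have c l : {within `[0, T], continuous (fun=> l : R)} by move=> u; exact: cvg_cst.
have [z _ hz] := EVT_max (ltW T0) cn.
set M := `|phi z - phi x| in hz.
have xin : `[0, T]%classic x by rewrite /= in_itv /= x0 ltW.
have /subspace_continuousP/(_ x xin)/cvgrPdist_lt/(_ _ e0)/nbhs_ballP[d /= d0 hd] := cphi.
pose C := M / d ^+ 2.
have M0 : 0 <= M by exact: normr_ge0.
have C0 : 0 <= C by rewrite divr_ge0 // sqr_ge0.
have key t : 0 <= t <= T -> `|phi t - phi x| <= eps * 1 + C * (t - x) ^+ 2.
  move=> tT; have [td|td] := ltP `|t - x| d.
    have := hd t; rewrite /ball /= distrC in_itv /= => /(_ td tT) h.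
    by rewrite mulr1 distrC; apply: le_trans (ltW h) _; rewrite lerDl mulr_ge0 // sqr_ge0.
  have := hz t; rewrite in_itv /= => /(_ tT) h; apply: le_trans h _.
  rewrite mulr1 ler_wpDl ?(ltW e0) // /C mulrAC ler_pdivlMr ?exprn_gt0 //.
  rewrite ler_wpM2l // -[leRHS]real_normK ?num_real // lerXn2r // nnegrE; exact: ltW.
exists C, (C * x ^+ 2 * r + `|phi x| * r / (r - 1)); split => //.
  have := ltW r0; have := ltW p => p' r0'.
  by apply: addr_ge0; [rewrite mulr_ge0 // mulr_ge0 // sqr_ge0|rewrite divr_ge0 // mulr_ge0].
move=> n m n0; set E := expR _.
have E0 : 0 <= E by exact: expR_ge0.
have /andP[G1 G2] := theta_mass_bound m n0 T0 r1; rewrite -/E in G2.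
have csq : {within `[0, T], continuous (fun t => (t - x) ^+ 2)}.
  apply: continuous_subspaceT => t; rewrite /continuous_at.
  by under eq_cvg do rewrite expr2; rewrite expr2; apply: cvgM; apply: cvgB; (exact: cvg_id || exact: cvg_cst).
have h1 : theta_int n T phi m - phi x =
    theta_int n T (fun t => phi t - phi x) m - phi x * (1 - theta_int n T (fun=> 1) m).
  have := theta_int_lin n 1 (- phi x) m cphi (c 1).
  have -> : (fun t => 1 * phi t + - phi x * 1) = (fun t => phi t - phi x).
    by apply/funext => t; rewrite mul1r mulr1.
  by move=> ->; ring.
have h2 : `|theta_int n T (fun t => phi t - phi x) m| <= eps + C * theta_int n T (fun t => (t - x) ^+ 2) m.
  apply: le_trans (_ : theta_int n T (fun t => eps * 1 + C * (t - x) ^+ 2) m <= _); last first.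
    rewrite theta_int_lin // lerD2r -[leRHS]mulr1 ler_wpM2l ?(ltW e0) //.
    by move: G1; rewrite subr_ge0.
  apply: le_trans (le_normr_Rintegral _ _) _ => //.
    by apply: segment_integrable; exact: theta_mul_continuous.
  have -> : \int[lebesgue_measure]_(t in `[0, T]) `|theta n m t * (phi t - phi x)| =
     theta_int n T (fun t => `|phi t - phi x|) m.
    apply: eq_Rintegral => t; rewrite inE /= in_itv /= => /andP[t0 _].
    by rewrite normrM ger0_norm // theta_ge0.
  apply: theta_int_le => // t; apply: cvgD; first exact: cvg_cst.
  by apply: cvgMr; exact: csq.
have h3 := theta_int_square x m n0 T0 r1; rewrite -/E in h3.
rewrite h1; apply: le_trans (ler_normB _ _) _; rewrite (normrM (phi x)) (ger0_norm G1).
have h4 := ler_wpM2l C0 h3; have h5 := ler_wpM2l (normr_ge0 (phi x)) G2.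
apply: le_trans (lerD h2 h5) _.
have -> : eps + C * quad n x m + (C * x ^+ 2 * r + `|phi x| * r / (r - 1)) * E * r ^+ m =
  eps + C * (quad n x m + x ^+ 2 * r * E * r ^+ m) + `|phi x| * (E * r ^+ m.+1 / (r - 1)).
  by rewrite (exprS r m); ring.
by rewrite lerD2r lerD2l.
Qed.
End ThetaApproximation.
(** * The operator and its derivatives *)

Section OperatorSeries.
Context {R : realType}.
Implicit Types (a : nat -> R) (b c r y w t T : R) (f : R -> R) (n k s : nat).

Lemma nbcoef_ge1 b k : 1 <= b -> 1 <= nbcoef b k.
Proof.
move=> b1; elim: k => [|k IH]; first by rewrite nbcoef0.
have p : 0 < k.+1%:R :> R by rewrite ltr0n.
rewrite -(ler_pM2l p) nbcoefS mulr1 -[leLHS]mulr1; apply: ler_pM => //.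
by rewrite -nat1r lerD2r.
Qed.

Lemma p_basisE n c k w : 0 < c -> 0 <= w ->
  p_basis n c k w = (1 + c * w) `^ (- (n%:R / c)) * (nbcoef (n%:R / c) k * (c * w / (1 + c * w)) ^+ k).
Proof.
move=> c0 w0; have p : 0 < 1 + c * w by rewrite ltr_wpDr // mulr_ge0 // ltW.
rewrite /p_basis /nbcoef powRN powRD; last by apply/implyP => _; rewrite gt_eqF.
rewrite powR_mulrn ?(ltW p) // expr_div_n; field.
by rewrite !gt_eqF // ?powR_gt0 // ?exprn_gt0 // ltr0n fact_gt0.
Qed.

(** The growth hypothesis makes the series converge, which is what allows the common power of
    [1 + c * w] to be taken out of [limn]. *)
Lemma L_op_nbsum n c f w : 0 < c -> (0 < n)%N -> 0 <= w ->
  subexp (fun k => \int[lebesgue_measure]_(t in halfline) (theta n k t * f t)) ->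
  L_op n c f w =
  nbsum (n%:R / c) (fun k => \int[lebesgue_measure]_(t in halfline) (theta n k t * f t)) (c * w).
Proof.
move=> c0 n0 w0 ha; rewrite /L_op /nbsum; set a := (fun k => _) in ha *.
have b0 : 0 < n%:R / c by rewrite divr_gt0 // ltr0n.
have cv := subexp_nbcvg b0 ha (mulr_ge0 (ltW c0) w0).
apply/cvg_lim => //.
rewrite [X in X @ _](_ : _ = fun m => (1 + c * w) `^ (- (n%:R / c)) *
   pseries (fun k => nbcoef (n%:R / c) k * a k) (c * w / (1 + c * w)) m).
  exact: cvgMr.
apply/funext => m; rewrite /pseries /series /= mulr_sumr.
by apply: eq_bigr => k _; rewrite p_basisE // -/(a k); move: (_ ^+ k) (_ `^ _) => u v; ring.
Qed.

Lemma derive_hln_nbsum g b c a s : 0 < b -> 0 < c -> subexp a ->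
  (forall w, 0 <= w -> g w = nbsum b a (c * w)) ->
  derivable_hln s g /\
  forall w, 0 <= w ->
    derive_hln s g w = rising b s * c ^+ s * nbsum (b + s%:R) (iter s fdiff a) (c * w).
Proof.
move=> b0 c0 ha hg.
have hD i : subexp (iter i fdiff a) by elim: i => //= i; exact: subexp_fdiff.
(* The function [g'] is arbitrary off the half-line, because the iterated derivative of [g] is known
   only there. *)
have step i (g' : R -> R) (C : R) :
    (forall w, 0 <= w -> g' w = C * nbsum (b + i%:R) (iter i fdiff a) (c * w)) ->
    forall w, 0 <= w -> derivable_hl g' w /\
      derive_hl g' w = C * ((b + i%:R) * c) * nbsum (b + i.+1%:R) (iter i.+1 fdiff a) (c * w).
  move=> hg' w w0.
  have bi : 0 < b + i%:R by rewrite ltr_wpDr.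
  have cw : 0 <= c * w by rewrite mulr_ge0 // ltW.
  have d1 : is_derive w 1 (fun u => c * u) c.
    apply: (is_derive_congr (is_deriveZ c (is_derive_id w 1))) => //.
    by rewrite /GRing.scale /= mulr1.
  have d2 := @is_derive1_comp R _ (fun u => c * u) w _ _ (is_derive_nbsum bi (hD i) cw) d1.
  have := derive_hl_eq w0 hg' (is_derive_congr (is_deriveZ C d2) (fun=> erefl) erefl).
  by case=> h1 h2; split => //; rewrite h2 /GRing.scale /= -addrA natr1; ring.
have val i : forall w, 0 <= w ->
    derive_hln i g w = rising b i * c ^+ i * nbsum (b + i%:R) (iter i fdiff a) (c * w).
  elim: i => [|i IH] w w0; first by rewrite /= /rising big_ord0 expr0 !mul1r addr0 hg.
  have [_ e] := step i _ _ IH w w0.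
  by rewrite /derive_hln iterS e risingS exprSr; ring.
split; last exact: val.
move=> i w _ w0.
by have [] := step i _ _ (val i) w w0.
Qed.
End OperatorSeries.

(** * Growth of the coefficients and tails of their integrals *)

Section OperatorTail.
Context {R : realType}.
Implicit Types (a : nat -> R) (b c r y w t T : R) (f : R -> R) (n k s : nat).
Local Notation mu := (@lebesgue_measure R).

Definition theta_coef n f k : R := \int[mu]_(t in halfline) (theta n k t * f t).

Lemma measurable_halfline : measurable (@halfline R).
Proof. exact: measurable_itv. Qed.
#[local] Hint Resolve measurable_halfline : core.

Lemma measurable_theta_mul n k f : measurable_fun halfline f ->
  measurable_fun halfline (fun t => theta n k t * f t).
Proof.
move=> mf; apply: measurable_funM => //; apply: measurable_funTS.
by apply: continuous_measurable_fun; exact: continuous_theta.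
Qed.

Lemma abs_theta_mul n k f t : halfline t ->
  (`|(theta n k t * f t)%:E| = (theta n k t * `|f t|)%:E)%E.
Proof. by rewrite halflineE => t0; rewrite abse_EFin normrM (ger0_norm (theta_ge0 n k t0)). Qed.

(** Finiteness at one well chosen point bounds each term of a nonnegative series by its sum. Since
    [n / c] is at least 1, [nbcoef] is at least 1, so the weight of the [k]-th term is at least a
    positive constant times [r ^- k]. *)
Lemma L_term_bound c f n r : 0 < c -> c < 1 -> (0 < n)%N -> 1 < r ->
  (forall w, 0 <= w -> (\sum_(0 <= k <oo) ((p_basis n c k w)%:E *
       \int[mu]_(t in halfline) (theta n k t * `|f t|)%:E) < +oo)%E) ->
  exists M, forall k,
    (\int[mu]_(t in halfline) (theta n k t * `|f t|)%:E <= (M * r ^+ k)%:E)%E.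
Proof.
move=> c0 c1 n0 r1 hL; have r0 : 0 < r by apply: lt_trans r1.
have p : 0 < r - 1 by rewrite subr_gt0.
(* At this point the ratio [y / (1 + y)] of the series equals [r^-1]. *)
pose y := (r - 1)^-1; pose w := y / c.
have y0 : 0 <= y by rewrite invr_ge0 ltW.
have w0 : 0 <= w by rewrite divr_ge0 // ltW.
have cw : c * w = y by rewrite /w mulrC divfK // gt_eqF.
pose J k := (\int[mu]_(t in halfline) (theta n k t * `|f t|)%:E)%E.
have J0 k : (0 <= J k)%E.
  by apply: integral_ge0 => t; rewrite halflineE => t0; rewrite lee_fin mulr_ge0 // theta_ge0.
have b1 : 1 <= n%:R / c.
  by rewrite ler_pdivlMr // mul1r; apply: le_trans (ltW c1) _; rewrite ler1n.
have b0 : 0 < n%:R / c by apply: lt_le_trans b1.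
have pb0 k : 0 <= p_basis n c k w.
  rewrite p_basisE // mulr_ge0 ?powR_ge0 // mulr_ge0 ?(ltW (nbcoef_gt0 _ b0)) // exprn_ge0 //.
  by rewrite cw divr_ge0 // addr_ge0.
have := hL w w0; set S := limn _ => Soo.
have tS k : ((p_basis n c k w)%:E * J k <= S)%E.
  have u0 j : (0 <= (p_basis n c j w)%:E * J j)%E by rewrite mule_ge0 // lee_fin.
  apply: le_trans (nneseries_lim_ge k.+1 (fun j _ _ => u0 j)).
  by rewrite big_nat_recr //= leeDr // sume_ge0.
have S0 : (0 <= S)%E by apply: le_trans (tS 0%N); rewrite mule_ge0 // lee_fin.
have SE : S = (fine S)%:E by rewrite fineK // ge0_fin_numE.
pose A := (1 + y) `^ (- (n%:R / c)).
have A0 : 0 < A by rewrite powR_gt0 // ltr_wpDr.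
exists (fine S / A) => k.
have q0 : 0 < A * r ^- k by rewrite mulr_gt0 // invr_gt0 exprn_gt0.
have -> : fine S / A * r ^+ k = (A * r ^- k)^-1 * fine S.
  by rewrite invfM invrK; ring.
rewrite EFinM lee_pdivlMl // -SE; apply: le_trans (tS k).
apply: (lee_wpmul2r (J0 k)); rewrite lee_fin p_basisE // cw -/A ler_wpM2l ?(ltW A0) //.
have -> : y / (1 + y) = r^-1.
  by rewrite /y; field; rewrite !gt_eqF // subrK gt_eqF.
rewrite exprVn -[leLHS]mul1r; apply: ler_wpM2r; last exact: nbcoef_ge1.
by rewrite invr_ge0 exprn_ge0 // ltW.
Qed.

Lemma theta_mul_integrable f n k : measurable_fun halfline f ->
  (\int[mu]_(t in halfline) (theta n k t * `|f t|)%:E < +oo)%E ->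
  mu.-integrable halfline (EFin \o (fun t => theta n k t * f t)).
Proof.
move=> mf h; apply/integrableP; split.
  by apply/measurable_EFinP; exact: measurable_theta_mul.
apply: le_lt_trans h; rewrite le_eqVlt; apply/orP; left; apply/eqP.
by apply: eq_integral => t; rewrite inE => tD; rewrite -abs_theta_mul.
Qed.

Lemma theta_coef_abs f n k (M : R) : measurable_fun halfline f ->
  (\int[mu]_(t in halfline) (theta n k t * `|f t|)%:E <= M%:E)%E ->
  `|theta_coef n f k| <= M.
Proof.
move=> mf h.
have hi := theta_mul_integrable mf (le_lt_trans h (ltry M)).
rewrite /theta_coef.
apply: le_trans (le_normr_Rintegral _ hi) _; first exact: measurable_halfline.
have -> : \int[mu]_(t in halfline) `|theta n k t * f t| = \int[mu]_(t in halfline) (theta n k t * `|f t|).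
  by apply: eq_Rintegral => t; rewrite inE => tD; have := abs_theta_mul n k f tD => -[].
rewrite /Rintegral -lee_fin fineK //.
rewrite ge0_fin_numE; first exact: le_lt_trans (ltry M).
by apply: integral_ge0 => t; rewrite halflineE => t0; rewrite lee_fin mulr_ge0 // theta_ge0.
Qed.

(** Beyond [T] the bound [theta_le] is compared with the fixed weight [theta n0 0], a multiple of
    [expR (- (n0%:R * t))], against which [f] is integrable. As [n (1 - 1/r)] is at least [n0], the
    quotient of the two exponentials is largest at [t = T]; this gives the decay at [T] and the
    constant [expR (n0%:R * T) / n0%:R]. *)
Lemma theta_coef_tail f n0 T r : (0 < n0)%N -> 0 < T -> 1 < r ->
  measurable_fun halfline f ->
  (\int[mu]_(t in halfline) (theta n0 0 t * `|f t|)%:E < +oo)%E ->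
  exists2 C, 0 <= C & forall n k, n0%:R <= n%:R * (1 - r^-1) ->
    mu.-integrable halfline (EFin \o (fun t => theta n k t * f t)) ->
    `|theta_coef n f k - theta_int n T f k|
      <= C * n%:R * expR (- (n%:R * (1 - r^-1) * T)) * r ^+ k.
Proof.
move=> n0p T0 r1 mf i0; have r0 : 0 < r by apply: lt_trans r1.
have N0 : 0 < n0%:R :> R by rewrite ltr0n.
have hi0 := theta_mul_integrable mf i0.
pose D : set R := `]T, +oo[%classic.
have mD : measurable D by exact: measurable_itv.
have DE t : D t -> T < t by rewrite /D /= in_itv /= andbT.
have DH : D `<=` halfline.
  by move=> t /DE; rewrite halflineE => /ltW; apply: le_trans; exact: ltW.
have HE : halfline = `[0, T]%classic `|` D :> set R.
  by apply: (@itv_bndbnd_setU _ _ _ (BRight T)); rewrite bnd_simp // ltW.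
have dis : [disjoint `[0, T]%classic & D].
  rewrite disj_set2E; apply/eqP/seteqP; split => // t /= [].
  by rewrite in_itv /= => /andP[_ h1] /DE /(le_lt_trans h1); rewrite ltxx.
pose K := \int[mu]_(t in D) (theta n0 0 t * `|f t|).
have hS g : mu.-integrable halfline g -> mu.-integrable D g.
  by move=> hg; apply: integrableS hg => //; exact: measurable_halfline.
have absint n k : mu.-integrable halfline (EFin \o (fun t => theta n k t * f t)) ->
   mu.-integrable D (EFin \o (fun t => theta n k t * `|f t|)).
  move=> /hS /integrable_abse.
  apply: eq_integrable => // t; rewrite inE => /DH tD.
  by rewrite /= -abs_theta_mul.
exists (expR (n0%:R * T) / n0%:R * K).
  rewrite mulr_ge0 ?divr_ge0 ?expR_ge0 //; apply: Rintegral_ge0 => t /DH.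
  by rewrite halflineE => t0; rewrite mulr_ge0 // theta_ge0.
move=> n k hn hi.
have -> : theta_coef n f k - theta_int n T f k = \int[mu]_(t in D) (theta n k t * f t).
  have hi' := hi; rewrite HE in hi'.
  by rewrite /theta_coef HE Rintegral_setU // addrC addKr.
apply: le_trans (le_normr_Rintegral _ (hS _ hi)) _ => //.
have -> : \int[mu]_(t in D) `|theta n k t * f t| = \int[mu]_(t in D) (theta n k t * `|f t|).
  by apply: eq_Rintegral => t; rewrite inE => /DH tD; have := abs_theta_mul n k f tD => -[].
set E := expR (- _).
pose A := expR (n0%:R * T) / n0%:R * n%:R * E * r ^+ k.
have -> : expR (n0%:R * T) / n0%:R * K * n%:R * E * r ^+ k = A * K by rewrite /A; ring.
have iA := absint _ _ hi0.
rewrite /K -RintegralZl //.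
apply: le_Rintegral => //; first exact: absint.
  by have := integrableZl _ A iA; apply.
move=> t tD; have t0 : 0 <= t by have := DH t tD; rewrite halflineE.
rewrite mulrA ler_wpM2r //; apply: le_trans (theta_le n k r0 t0) _.
have -> : A * theta n0 0 t = n%:R * r ^+ k * expR (n0%:R * T - n%:R * (1 - r^-1) * T - n0%:R * t).
  rewrite /A /theta !expr0 fact0 divr1 mulr1 !expRD -/E; field.
  by rewrite gt_eqF.
apply: ler_wpM2l; first by rewrite mulr_ge0 // exprn_ge0 // ltW.
rewrite ler_expR.
have tT := ltW (DE t tD).
have := mulr_ge0 (_ : 0 <= n%:R * (1 - r^-1) - n0%:R) (_ : 0 <= t - T).
rewrite !subr_ge0 => /(_ hn tT); lra.
Qed.
End OperatorTail.
(** * Asymptotic estimates *)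

Section FinalEstimates.
Context {R : realType}.
Implicit Types (a d : nat -> R) (b c r x y w t T : R) (f : R -> R) (n k s : nat).

Lemma iter_fdiffB s a a' :
  iter s fdiff (fun k => a k - a' k) = (fun k => iter s fdiff a k - iter s fdiff a' k).
Proof.
elim: s => //= s ->; apply/funext => k; rewrite /fdiff; ring.
Qed.

Lemma iter_fdiff_le s a (M r : R) : 0 <= r -> (forall k, `|a k| <= M * r ^+ k) ->
  forall k, `|iter s fdiff a k| <= M * (r + 1) ^+ s * r ^+ k.
Proof.
move=> r0 ha; elim: s => [|s IH] k; first by rewrite /= expr0 mulr1.
rewrite iterS /fdiff; apply: le_trans (ler_normB _ _) _.
apply: le_trans (lerD (IH k.+1) (IH k)) _.
by rewrite (exprS r) (exprS (r + 1)) le_eqVlt; apply/orP; left; apply/eqP; ring.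
Qed.

(** The quantity [quad n x (k + s)] is quadratic in [k], so its mean follows from three moments; the
    contributions of order 1 cancel, which leaves order [1 / n]. *)
Lemma nbsum_quad c s x : 0 < c -> 0 <= x ->
  exists2 K, 0 <= K & forall n, (0 < n)%N ->
    nbcvg (n%:R / c + s%:R) (fun k => quad n x (k + s)) (c * x) /\
    nbsum (n%:R / c + s%:R) (fun k => quad n x (k + s)) (c * x) <= K / n%:R.
Proof.
move=> c0 x0.
have y0 : 0 <= c * x by rewrite mulr_ge0 // ltW.
(* [A] is the coefficient of [n%:R ^- 2] in the mean computed below; it joins the constant through
   [n <= n ^ 2]. *)
pose A := s%:R ^+ 2 * c ^+ 2 * x ^+ 2 + s%:R * c ^+ 2 * x ^+ 2
  + (2 * s%:R + 4) * s%:R * c * x + (s%:R + 1) * (s%:R + 2).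
have A0 : 0 <= A.
  have c0' := ltW c0.
  by rewrite /A !addr_ge0 // ?mulr_ge0 ?sqr_ge0 ?addr_ge0 ?mulr_ge0.
exists (c * x ^+ 2 + 2 * x + A).
  by rewrite !addr_ge0 // ?mulr_ge0 ?sqr_ge0 // ltW.
move=> n n0; have N0 : 0 < n%:R :> R by rewrite ltr0n.
set B := n%:R / c + s%:R.
have B0 : 0 < B by rewrite ltr_wpDr // divr_gt0.
(* Coordinates of [quad n x (k + s)] in the basis [k (k - 1) / 2], [k], 1. *)
pose l1 := 2 / n%:R ^+ 2 : R.
pose l2 := (2 * s%:R + 4) / n%:R ^+ 2 - 2 * x / n%:R.
pose l3 := (s%:R + 1) * (s%:R + 2) / n%:R ^+ 2 - 2 * x * (s%:R + 1) / n%:R + x ^+ 2.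
have qE : (fun k => quad n x (k + s)) =
    (fun k => l1 * (k%:R * (k%:R - 1) / 2) + 1 * (l2 * k%:R + l3 * 1)).
  apply/funext => k; rewrite /quad /l1 /l2 /l3 -addn1 -[(_ + _).+1]addn1 -[in _.+1]addn1 !natrD; field.
  by rewrite gt_eqF.
have c1 := subexp_nbcvg B0 subexp_bin2 y0.
have c2 := subexp_nbcvg B0 subexp_nat y0.
have c3 := subexp_nbcvg B0 (subexp_cst 1) y0.
have [c4 e4] := nbsum_lin l2 l3 c2 c3.
have [c5 e5] := nbsum_lin l1 1 c1 c4.
rewrite qE; split => //.
rewrite e5 e4 nbsum_bin2 // nbsum_nat // nbsum_cst //.
have -> : l1 * (B * (B + 1) * (c * x) ^+ 2 / 2) + 1 * (l2 * (B * (c * x)) + l3 * 1) =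
    (c * x ^+ 2 + 2 * x) / n%:R + A / n%:R ^+ 2.
  rewrite /l1 /l2 /l3 /A /B; field; by rewrite !gt_eqF.
rewrite [leRHS]mulrDl lerD2l ler_wpM2l // lef_pV2 ?posrE ?exprn_gt0 //.
by rewrite ler_eXnr // ler1n.
Qed.

(** The exponential of [n * beta] dominates the term of degree [m + 1] of its series; this pays for
    [n ^ m] and leaves one factor [1 / n]. *)
Lemma expR_decay (beta : R) m : 0 < beta ->
  exists2 K, 0 <= K & forall n, (0 < n)%N ->
    n%:R ^+ m * expR (- (n%:R * beta)) <= K / n%:R.
Proof.
move=> b0; exists (m.+1`!%:R / beta ^+ m.+1).
  by rewrite divr_ge0 // exprn_ge0 // ltW.
move=> n n0; have N0 : 0 < n%:R :> R by rewrite ltr0n.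
have h : (n%:R * beta) ^+ m.+1 / m.+1`!%:R <= expR (n%:R * beta).
  by apply: exprn_fact_le_expR; rewrite mulr_ge0 // ltW.
rewrite expRN ler_pdivrMr ?expR_gt0 //.
apply: le_trans (ler_wpM2l _ h); last first.
  by rewrite divr_ge0 // divr_ge0 // exprn_ge0 // ltW.
rewrite le_eqVlt; apply/orP; left; apply/eqP.
rewrite exprMn (exprS n%:R); field.
by rewrite !gt_eqF // ?exprn_gt0 // ltr0n fact_gt0.
Qed.

Lemma geometric_decay c s x : 0 < c -> c < 1 -> 0 <= x ->
  exists r : R, [/\ 1 < r, r * (c * x) < 1 + c * x & exists2 K, 0 <= K &
    forall n, (0 < n)%N ->
      n%:R ^+ s.+1 * expR (- (n%:R * (1 - r^-1) * (x + 1)))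
        * (1 + c * x - r * (c * x)) `^ (- (n%:R / c + s%:R)) <= K / n%:R].
Proof.
move=> c0 c1 x0; have x1 : 0 < x + 1 by rewrite ltr_wpDl.
(* With r = 1 + u the exponent is n times [x u / (1 - c x u) - (x + 1) u / (1 + u)],
   which is negative as soon as [u (x + c x (x + 1)) < 1]. *)
pose u := (x + 1) ^- 2; have u0 : 0 < u by rewrite invr_gt0 exprn_gt0.
have ux : u * (x + 1) ^+ 2 = 1 by rewrite mulVf // gt_eqF // exprn_gt0.
have cx : c * x <= x by rewrite ler_piMl // ltW.
have cxx : c * x * x <= x * x by rewrite ler_wpM2r.
(* Because [c < 1], the bracket is at most [x ^+ 2 + 2 * x], which is less than
   [(x + 1) ^+ 2 = u^-1]. *)
have ul : u * (x + c * x * (x + 1)) < 1.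
  by rewrite -ux ltr_pM2l //; nra.
pose v := 1 - u * c * x.
have v0 : 0 < v.
  have : 0 <= u * (x + c * x * x) by rewrite mulr_ge0 ?(ltW u0) // addr_ge0 // !mulr_ge0 // ltW.
  by move: ul; rewrite /v; nra.
pose beta := u / (1 + u) * (x + 1) - x * u / v.
have u1 : 0 < 1 + u by rewrite addr_gt0.
have b0 : 0 < beta.
  have -> : beta = u * (1 - u * (x + c * x * (x + 1))) / ((1 + u) * v).
    by rewrite /beta /v; field; rewrite -/v !gt_eqF.
  by rewrite divr_gt0 // mulr_gt0 // subr_gt0.
have [K K0 hK] := expR_decay s.+1 b0.
exists (1 + u); split.
- by rewrite ltrDl.
- by move: v0; rewrite /v; nra.
exists (K * v `^ (- s%:R)); first by rewrite mulr_ge0 // powR_ge0.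
move=> n n0; have N0 : 0 < n%:R :> R by rewrite ltr0n.
have -> : 1 + c * x - (1 + u) * (c * x) = v by rewrite /v; ring.
rewrite opprD powRD; last by apply/implyP => _; rewrite gt_eqF.
rewrite [leLHS]mulrA [leRHS]mulrAC.
apply: ler_wpM2r; first exact: powR_ge0.
apply: le_trans (hK n n0).
rewrite -mulrA; apply: ler_wpM2l; first by rewrite exprn_ge0.
have -> : - (n%:R * beta) = - (n%:R * (1 - (1 + u)^-1) * (x + 1)) + n%:R * (x * u / v).
  by rewrite /beta; field; rewrite !gt_eqF.
rewrite expRD; apply: ler_wpM2l; first exact: expR_ge0.
rewrite /powR gt_eqF // ler_expR.
(* This is [ln q <= q - 1] at [q = v^-1]; multiplied by [n / c], it bounds the logarithm of the
   power of [v] by [n * (x * u / v)]. *)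
have hl : - ln v <= u * c * x / v.
  rewrite -lnV ?posrE //.
  have := @expR_ge1Dx R (ln v^-1); rewrite lnK ?posrE ?invr_gt0 // => h.
  have : v^-1 = 1 + u * c * x / v by rewrite /v; field; rewrite -/v gt_eqF.
  by move=> e; move: h; rewrite [leRHS]e lerD2l.
have -> : - (n%:R / c) * ln v = n%:R / c * - ln v by rewrite mulrN mulNr.
have -> : n%:R * (x * u / v) = n%:R / c * (u * c * x / v).
  by field; rewrite !gt_eqF.
by apply: ler_wpM2l => //; rewrite divr_ge0 // ltW.
Qed.
End FinalEstimates.

(** * Approximation of the differenced coefficients, uniformly in the index *)

Section Approximation.
Context {R : realType}.
Implicit Types (c r x T : R) (f : R -> R) (n k s : nat).

Lemma C_hl_measurable s f : C_hl s f -> measurable_fun halfline f.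
Proof.
move=> hf; apply: subspace_continuous_measurable_fun (C_hl_continuous hf (leq0n s)).
exact: measurable_halfline.
Qed.

Lemma L_defined_coef c f : 0 < c -> c < 1 -> measurable_fun halfline f -> L_defined c f ->
  exists2 n0, (0 < n0)%N & forall n, (n0 <= n)%N -> subexp (theta_coef n f) /\
    forall k, (\int[lebesgue_measure]_(t in halfline) (theta n k t * `|f t|)%:E < +oo)%E.
Proof.
(* Moving from [n0] to its successor excludes [n = 0]. *)
move=> c0 c1 mf [n0 _ hn0]; exists n0.+1 => // n hn.
have n_gt0 : (0 < n)%N by apply: leq_trans hn.
have hw := hn0 n (ltnW hn).
split=> [r r1|k].
  have [M hM] := L_term_bound c0 c1 n_gt0 r1 hw.
  by exists M => k; apply: theta_coef_abs.
have [M hM] := L_term_bound c0 c1 n_gt0 (ltr1n R 2) hw.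
exact: le_lt_trans (hM k) (ltry _).
Qed.

(** Three errors are added: concentration of the kernel at index [k + s], the boundary terms at
    [x + 1], and the [s]-th difference of the tail. The bound combines a constant, [quad] and
    [r ^+ k], the three sequences whose means are under control. *)
Lemma iter_fdiff_coef_approx c s f x r (eps : R) : 0 < c -> c < 1 -> C_hl s f -> L_defined c f ->
  0 <= x -> 1 < r -> 0 < eps ->
  exists C D : R, [/\ 0 <= C, 0 <= D & \forall n \near \oo, forall k,
    `|n%:R ^+ s * iter s fdiff (theta_coef n f) k - derive_hln s f x| <=
      eps + C * quad n x (k + s)
      + D * (n%:R ^+ s.+1 * expR (- (n%:R * (1 - r^-1) * (x + 1)))) * r ^+ k].
Proof.
move=> c0 c1 hf hL x0 r1 e0.
have r0 : 0 < r by apply: lt_trans r1.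
pose T := x + 1; have T0 : 0 < T by rewrite ltr_wpDl.
have xT : x < T by rewrite ltrDl.
have mf := C_hl_measurable hf.
have cseg i : (i <= s)%N -> {within `[0, T], continuous (derive_hln i f)}.
  move=> ile; apply: continuous_subspaceW (C_hl_continuous hf ile) => t /=.
  by rewrite halflineE in_itv /= => /andP[].
have [C [C' [C0 C'0 hC]]] := theta_int_approx x0 xT r1 (cseg s (leqnn s)) e0.
have [C2 C20 hC2] := @theta_int_iter_diff R T r (derive_hln ^~ f) s T0 r1 cseg (fun i h => C_hl_segment hf h T0).
have [n0 n0_gt0 hn0] := L_defined_coef c0 c1 mf hL.
(* Finiteness at [n0] and [k = 0] supplies the exponential weight with which all tails are
   compared. *)
have [C3 C30 hC3] := theta_coef_tail n0_gt0 T0 r1 mf ((hn0 n0 (leqnn _)).2 0%N).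
exists C, (C' * r ^+ s + C2 + C3 * (r + 1) ^+ s); split => //.
  by rewrite !addr_ge0 // mulr_ge0 // exprn_ge0 // ?addr_ge0 // ltW.
have q0 : 0 < 1 - r^-1 by rewrite subr_gt0 invf_lt1.
near=> n => k.
have n0n : (n0 <= n)%N by near: n; exact: nbhs_infty_ge.
have n_gt0 : (0 < n)%N by apply: leq_trans n0n.
have [_ fin] := hn0 n n0n.
have hn : n0%:R <= n%:R * (1 - r^-1).
  by rewrite -ler_pdivrMr //; near: n; exact: nbhs_infty_ger.
set E := expR _.
have E0 : 0 <= E by exact: expR_ge0.
have n1 : 1 <= n%:R :> R by rewrite ler1n.
have rk : 0 <= r ^+ k by rewrite exprn_ge0 // ltW.
have h1 := hC n (k + s)%N n_gt0.
have h2 := hC2 n k n_gt0.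
have h3 j : `|theta_coef n f j - theta_int n T f j| <= C3 * n%:R * E * r ^+ j.
  by apply: hC3 => //; exact: theta_mul_integrable.
have h4 := iter_fdiff_le s (ltW r0) h3 k; rewrite iter_fdiffB in h4.
rewrite -/E in h1 h2.
set a := iter s fdiff (theta_coef n f) k in h4 *.
set i1 := iter s fdiff _ k in h2 h4.
set i2 := theta_int _ _ _ _ in h1 h2.
have -> : n%:R ^+ s * a - derive_hln s f x =
   (i2 - derive_hln s f x) + (n%:R ^+ s * i1 - i2) + n%:R ^+ s * (a - i1) by ring.
apply: le_trans (ler_normD _ _) _; apply: le_trans (lerD (ler_normD _ _) (lexx _)) _.
have ns : 0 <= n%:R ^+ s :> R by rewrite exprn_ge0.
rewrite (normrM (_ ^+ s)) (ger0_norm ns).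
apply: le_trans (lerD (lerD h1 h2) (ler_wpM2l ns h4)) _.
(* The concentration error carries no power of [n]; the factor [n ^ (s + 1)], at least 1, is
   inserted to merge it with the other two. *)
have h5 : C' * E * r ^+ (k + s) <= C' * r ^+ s * (n%:R ^+ s.+1 * E) * r ^+ k.
  rewrite exprD.
  have -> : C' * E * (r ^+ k * r ^+ s) = (C' * r ^+ s * E * r ^+ k) * 1 by ring.
  have -> : C' * r ^+ s * (n%:R ^+ s.+1 * E) * r ^+ k = (C' * r ^+ s * E * r ^+ k) * n%:R ^+ s.+1 by ring.
  by apply: ler_wpM2l; rewrite ?exprn_ege1 // !mulr_ge0 // exprn_ge0 // ltW.
have -> : n%:R ^+ s * (C3 * n%:R * E * (r + 1) ^+ s * r ^+ k) =
    C3 * (r + 1) ^+ s * (n%:R ^+ s.+1 * E) * r ^+ k by rewrite exprS; ring.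
have -> : C2 * n%:R ^+ s.+1 * E * r ^+ k = C2 * (n%:R ^+ s.+1 * E) * r ^+ k by ring.
by rewrite !mulrDl !addrA !lerD2r -!addrA lerD2l lerD2l.
Unshelve. all: by end_near.
Qed.
End Approximation.

(** * Convergence of the normalized derivatives of the operator *)

Theorem theorem1 (R : realType) (c : R) (s : nat) (f : R -> R) (x : R)
    (hc0 : 0 < c) (hc1 : c < 1) (hf : C_hl s f) (hL : L_defined c f)
    (hx : 0 <= x) :
  (\forall n \near \oo, derivable_hln s (L_op n c f)) /\
  (lambda n c s)^-1 * derive_hln s (L_op n c f) x @[n --> \oo]
    --> derive_hln s f x.
Proof.
have [n0 n0_gt0 hn0] := L_defined_coef hc0 hc1 (C_hl_measurable hf) hL.
have LE n : (n0 <= n)%N -> derivable_hln s (L_op n c f) /\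
    forall w, 0 <= w -> derive_hln s (L_op n c f) w = rising (n%:R / c) s * c ^+ s *
      nbsum (n%:R / c + s%:R) (iter s fdiff (theta_coef n f)) (c * w).
  move=> hn; have n_gt0 := leq_trans n0_gt0 hn; have [ha _] := hn0 n hn.
  apply: derive_hln_nbsum => //; first by rewrite divr_gt0 // ltr0n.
  by move=> w w0; exact: L_op_nbsum.
split; first by exists n0 => // n /LE[].
have y0 : 0 <= c * x by rewrite mulr_ge0 // ltW.
have [r [r1 ry [K1 K10 hK1]]] := geometric_decay s hc0 hc1 hx.
have [K2 K20 hK2] := nbsum_quad s hc0 hx.
apply/cvgrPdist_lt => eps eps0.
have e2 : 0 < eps / 2 by rewrite divr_gt0.
have [C [D [C0 D0 hCD]]] := iter_fdiff_coef_approx hc0 hc1 hf hL hx r1 e2.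
near=> n.
have n0n : (n0 <= n)%N by near: n; exact: nbhs_infty_ge.
(* Beyond this threshold the means of the [quad] and [r ^+ k] terms, both of order [1 / n], add up
   to less than [eps / 2]. *)
have hN : (C * K2 + D * K1) / (eps / 2) < n%:R by near: n; exact: nbhs_infty_gtr.
have n_gt0 : (0 < n)%N := leq_trans n0_gt0 n0n.
have N0 : 0 < n%:R :> R by rewrite ltr0n.
have b0 : 0 < n%:R / c by rewrite divr_gt0.
have B0 : 0 < n%:R / c + s%:R by rewrite ltr_wpDr.
have hk : forall k, `|n%:R ^+ s * iter s fdiff (theta_coef n f) k - derive_hln s f x| <=
    eps / 2 + C * quad n x (k + s)
    + D * (n%:R ^+ s.+1 * expR (- (n%:R * (1 - r^-1) * (x + 1)))) * r ^+ k.
  by near: n; exact: hCD.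
have [ha _] := hn0 n n0n; have [_ ->] // := LE n n0n.
set a := iter s fdiff (theta_coef n f) in hk *.
have sa : subexp a by rewrite /a; elim: (s) => //= i; exact: subexp_fdiff.
set B := n%:R / c + s%:R in B0 *.
(* The normalization cancels the rising factorial and the power of [c] produced by
   differentiation. *)
have -> : (lambda n c s)^-1 * (rising (n%:R / c) s * c ^+ s * nbsum B a (c * x)) =
    n%:R ^+ s * nbsum B a (c * x).
  rewrite /lambda; field.
  by rewrite !gt_eqF // ?exprn_gt0 // rising_gt0.
have [cq hq] := hK2 n n_gt0; rewrite -/B in cq hq.
have [cg eg] := nbsum_geometric B0 y0 (ltW (lt_trans ltr01 r1)) ry.
have c1 := subexp_nbcvg B0 (subexp_cst 1) y0.
have ca := subexp_nbcvg B0 sa y0.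
(* Since constants are their own means, the error is the mean of the centred sequence, and the
   pointwise bound [hk] passes through the mean. *)
have [cd ed] := nbsum_lin (n%:R ^+ s) (- derive_hln s f x) ca c1.
set E := n%:R ^+ s.+1 * _ in hk.
have [cm em] := nbsum_lin (eps / 2) C c1 cq.
have [cM eM] := nbsum_lin 1 (D * E) cm cg.
rewrite distrC.
have := nbsum_norm_le B0 y0 cd cM.
rewrite ed eM em nbsum_cst // eg !mulr1 mul1r => H.
apply: le_lt_trans (H _) _ => [k|].
  by rewrite mul1r; exact: hk.
have h1 := hK1 n n_gt0; rewrite -/E -/B in h1.
have h2 := ler_wpM2l C0 hq; have h3 := ler_wpM2l D0 h1.
have h4 : (C * K2 + D * K1) / n%:R < eps / 2.
  by rewrite ltr_pdivrMr // [ltRHS]mulrC -ltr_pdivrMr.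
by move: h4 h2 h3; rewrite mulrDl [D * (E * _)]mulrA !(mulrA _ _ n%:R^-1); lra.
Unshelve. all: by end_near.
Qed.
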